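(* Let $G$ be a finitely generated, torsion-free, commutative transitive group. Let $\mathcal{E}$ be the class of infinite cyclic subgroups of $G$, and let $\sim$ be commensurability. Let $T$ be an $\mathcal{E}$-tree, with tree of cylinders $T_c$ and collapsed tree of cylinders $T_c^*$. Then: 1. $T_c^*$ and $T_c$ are in the same deformation space. 2. Every non-cyclic vertex stabilizer of $T$ is a vertex stabilizer of $T_c$ and $T_c^*$, and every other non-cyclic vertex stabilizer of $T_c^*$ is isomorphic to some $BS(1,s)$. Every subgroup isomorphic to some $BS(1,s)$ is elliptic in $T_c$ and $T_c^*$. In particular, $T_c$ and $T_c^*$ belong to the same deformation space as $T$ if and only if every subgroup of $G$ isomorphic to a $BS(1,s)$ is elliptic in $T$. 3. $T_c^*$ is $2$-acylindrical and dominates any acylindrical $\mathcal{E}$-tree which is dominated by $T$.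
   Context: $G$ is commutative transitive if centralizers of non-trivial elements are abelian. For $s\neq0$, $BS(1,s)=\langle a,t\mid tat^{-1}=a^s\rangle$ (so $BS(1,1)=\mathbb{Z}^2$). Subgroups $A,B$ are commensurable if $A\cap B$ has finite index in both. A tree is a simplicial tree with an action of $G$ without inversions; $G_e$ is the stabilizer of an edge $e$. An $\mathcal{E}$-tree is a tree all of whose edge stabilizers belong to $\mathcal{E}$. A subgroup is elliptic in a tree if it fixes a point. $T$ dominates $T'$ if there is a $G$-equivariant map $T\to T'$, equivalently if every subgroup elliptic in $T$ is elliptic in $T'$. Two trees are in the same deformation space if they have the same elliptic subgroups. A tree is $k$-acylindrical if the (pointwise) stabilizer of any segment of length $>k$ is trivial, and acylindrical if this holds for some $k$. Tree of cylinders. Declare two edges $e,e'$ of $T$ equivalent if $G_e\sim G_{e'}$. A cylinder of $T$ is an equivalence class $Y$ of edges, identified with the union of its edges; cylinders are subtrees of $T$ and two distinct cylinders meet in at most one point. $T_c$ is the bipartite tree with vertex set $V_0(T_c)\sqcup V_1(T_c)$, where $V_0(T_c)$ is the set of vertices of $T$ belonging to at least two distinct cylinders, $V_1(T_c)$ is the set of cylinders of $T$, and there is an edge $(x,Y)$ between $x\in V_0(T_c)$ and $Y\in V_1(T_c)$ if and only if $x\in Y$. It carries the induced $G$-action. If $T$ is a single point, $T_c$ is understood to be a point. $T_c^*$ is obtained from $T_c$ by collapsing all edges whose stabilizer is not in $\mathcal{E}$. *)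

(* Defs.v *)
From HB Require Import structures.
From mathcomp Require Import all_boot all_order all_algebra.
From mathcomp Require Import all_classical.
From Stdlib Require Import Relation_Operators.

Set Implicit Arguments.
Unset Strict Implicit.
Unset Printing Implicit Defensive.

Local Open Scope classical_set_scope.
Local Open Scope quotient_scope.
Local Open Scope group_scope.

Section Subgroups.
Variable G : groupType.
Implicit Types (H K S : set G) (g x y : G).

Definition expgz x (k : int) : G :=
  match k with Posz n => x ^+ n | Negz n => x ^- n.+1 end.

Definition is_subgroup H : Prop :=
  H 1 /\ forall x y, H x -> H y -> H (x * y^-1).

Definition fin_generated : Prop :=
  exists2 S, finite_set S &
    forall H, is_subgroup H -> S `<=` H -> H = setT.

Definition torsion_free : Prop :=
  forall x (n : nat), (0 < n)%N -> x ^+ n = 1 -> x = 1.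

Definition centralizer x : set G := [set y | commute x y].

Definition is_abelian H : Prop := forall x y, H x -> H y -> commute x y.

Definition commutative_transitive : Prop :=
  forall x, x <> 1 -> is_abelian (centralizer x).

Definition is_cyclic H : Prop := exists x, H = range (expgz x).

Definition infinite_cyclic H : Prop := is_cyclic H /\ infinite_set H.

Definition left_coset x H : set G := [set x * h | h in H].

Definition finite_index K H : Prop := finite_set [set left_coset x K | x in H].

Definition commensurable H K : Prop :=
  finite_index (H `&` K) H /\ finite_index (H `&` K) K.

Definition conjugate_by g H : set G := [set g * h * g^-1 | h in H].

Lemma conjugate_byE g H x : conjugate_by g H x <-> H (g^-1 * x * g).
Proof.
split=> [[h Hh <-]|Hx]; first by rewrite !mulgA mulVg mul1g mulgVK.
by exists (g^-1 * x * g) => //; rewrite !mulgA mulgV mul1g mulgK.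
Qed.

Lemma conjugate_byI g H K :
  conjugate_by g (H `&` K) = conjugate_by g H `&` conjugate_by g K.
Proof.
apply/seteqP; split=> x; first by move=> /conjugate_byE[]; split; exact/conjugate_byE.
by move=> [/conjugate_byE Hx /conjugate_byE Kx]; apply/conjugate_byE.
Qed.

Lemma left_coset_conjugate g x K :
  left_coset (g * x * g^-1) (conjugate_by g K) = conjugate_by g (left_coset x K).
Proof.
rewrite /left_coset /conjugate_by !image_comp; apply: eq_imagel => k _ /=.
by rewrite !mulgA mulgVK.
Qed.

Lemma finite_index_conjugate g H K :
  finite_index K H -> finite_index (conjugate_by g K) (conjugate_by g H).
Proof.
move=> /(finite_image (conjugate_by g)); rewrite /finite_index !image_comp.
by under eq_imagel => x _ do rewrite /= -left_coset_conjugate.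
Qed.

Lemma commensurable_conjugate g H K :
  commensurable H K -> commensurable (conjugate_by g H) (conjugate_by g K).
Proof.
by move=> [HK KH]; split; rewrite -conjugate_byI; exact: finite_index_conjugate.
Qed.

Lemma is_cyclic_conjugate g H : is_cyclic H -> is_cyclic (conjugate_by g H).
Proof.
have conjX x n : g * (x ^+ n) * g^-1 = (g * x * g^-1) ^+ n.
  have := conjXg x g^-1 n; rewrite /conjg invgK !mulgA => ->.
  by [].
move=> [x ->]; exists (g * x * g^-1); rewrite /conjugate_by image_comp.
apply: eq_imagel => -[n|n] _ //=.
by rewrite -conjX !invgM invgK mulgA.
Qed.

Lemma infinite_cyclic_conjugate g H :
  infinite_cyclic H -> infinite_cyclic (conjugate_by g H).
Proof.
move=> [cH iH]; split; first exact: is_cyclic_conjugate.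
move=> /(finite_image (fun x => g^-1 * x * g)) fH; apply: iH.
suff -> : H = [set g^-1 * x * g | x in conjugate_by g H] by [].
apply/seteqP; split=> [x Hx|_ [x /conjugate_byE Hx <-]] //.
exists (g * x * g^-1); first by exists x.
by rewrite !mulgA mulVg mul1g mulgVK.
Qed.

End Subgroups.

(* In a word over X, the letter (x, true) stands for the generator x and
   (x, false) for its inverse. *)

Section Presentation.
Variables (X : choiceType) (R : set (seq (X * bool))).

Inductive pres_eq : seq (X * bool) -> seq (X * bool) -> Prop :=
| pres_refl w : pres_eq w w
| pres_sym w1 w2 : pres_eq w1 w2 -> pres_eq w2 w1
| pres_trans w1 w2 w3 : pres_eq w1 w2 -> pres_eq w2 w3 -> pres_eq w1 w3
| pres_cat u1 u2 w1 w2 :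
    pres_eq u1 u2 -> pres_eq w1 w2 -> pres_eq (u1 ++ w1) (u2 ++ w2)
| pres_cancel x b : pres_eq [:: (x, b); (x, ~~ b)] [::]
| pres_relator r : R r -> pres_eq r [::].

Definition pres_eqb : rel (seq (X * bool)) := fun u v => `[< pres_eq u v >].

Lemma pres_eqb_refl : reflexive pres_eqb.
Proof. by move=> w; apply/asboolP; exact: pres_refl. Qed.

Lemma pres_eqb_sym : symmetric pres_eqb.
Proof. by move=> u v; apply/asboolP/asboolP; exact: pres_sym. Qed.

Lemma pres_eqb_trans : transitive pres_eqb.
Proof.
by move=> v u w /asboolP uv /asboolP vw; apply/asboolP; exact: pres_trans uv vw.
Qed.

Canonical pres_equiv := EquivRel pres_eqb pres_eqb_refl pres_eqb_sym pres_eqb_trans.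

Definition presented := {eq_quot pres_equiv}.
HB.instance Definition _ := Choice.on presented.

Definition inv_word (w : seq (X * bool)) : seq (X * bool) :=
  rev [seq (l.1, ~~ l.2) | l <- w].

Definition pres_one : presented := \pi_presented [::].
Definition pres_mul (u v : presented) : presented :=
  \pi_presented (repr u ++ repr v).
Definition pres_inv (u : presented) : presented :=
  \pi_presented (inv_word (repr u)).

Lemma pres_piP u v : \pi_presented u = \pi_presented v <-> pres_eq u v.
Proof.
split=> [/eqP|uv]; first by rewrite eqmodE => /asboolP.
by apply/eqP; rewrite eqmodE; exact/asboolP.
Qed.

Lemma pres_repr w : pres_eq (repr (\pi_presented w)) w.
Proof. by apply/pres_piP; rewrite reprK. Qed.

Lemma pres_mulA : associative pres_mul.
Proof.
move=> u v w; apply/pres_piP; apply: (@pres_trans _ (repr u ++ repr v ++ repr w)).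
  by apply: pres_cat; [exact: pres_refl | exact: pres_repr].
rewrite catA; apply: pres_cat; last exact: pres_refl.
exact/pres_sym/pres_repr.
Qed.

Lemma pres_mul1 : left_id pres_one pres_mul.
Proof.
move=> u; rewrite -[RHS]reprK; apply/pres_piP.
by apply: (@pres_cat _ [::]); [exact: pres_repr | exact: pres_refl].
Qed.

Lemma pres_mulr1 : right_id pres_one pres_mul.
Proof.
move=> u; rewrite -[RHS]reprK; apply/pres_piP; rewrite -[X in pres_eq _ X]cats0.
by apply: pres_cat; [exact: pres_refl | exact: pres_repr].
Qed.

Lemma pres_inv_word w : pres_eq (inv_word w ++ w) [::].
Proof.
elim: w => [|[x b] w IH]; first exact: pres_refl.
rewrite /inv_word /= rev_cons cat_rcons -/(inv_word w).
apply: pres_trans IH; apply: pres_cat; first exact: pres_refl.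
apply: (@pres_cat [:: (x, ~~ b); (x, b)] [::]); last exact: pres_refl.
by have := pres_cancel x (~~ b); rewrite negbK.
Qed.

Lemma pres_inv_wordr w : pres_eq (w ++ inv_word w) [::].
Proof.
elim: w => [|[x b] w IH]; first exact: pres_refl.
rewrite /inv_word /= rev_cons -/(inv_word w) -cats1 catA.
apply: pres_trans (pres_cancel x b).
apply: (@pres_cat [:: (x, b)] [:: (x, b)]); first exact: pres_refl.
apply: (@pres_cat (w ++ inv_word w) [::]) => //; exact: pres_refl.
Qed.

Lemma pres_mulV : left_inverse pres_one pres_inv pres_mul.
Proof.
move=> u; apply/pres_piP; apply: pres_trans (pres_inv_word (repr u)).
by apply: pres_cat; [exact: pres_repr | exact: pres_refl].
Qed.

Lemma pres_mulrV : right_inverse pres_one pres_inv pres_mul.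
Proof.
move=> u; apply/pres_piP; apply: pres_trans (pres_inv_wordr (repr u)).
by apply: pres_cat; [exact: pres_refl | exact: pres_repr].
Qed.

HB.instance Definition _ := isGroup.Build presented
  pres_mulA pres_mul1 pres_mulr1 pres_mulV pres_mulrV.

End Presentation.

(* The relator t a t^-1 a^-s, with a = false and t = true as generators. *)
Definition BS_relator (s : int) : seq (bool * bool) :=
  [:: (true, true); (false, true); (true, false)]
    ++ nseq `|s|%N (false, (s < 0)%R).

Definition BS1 (s : int) : groupType := presented [set BS_relator s].

Definition isomorphic_to (K G : groupType) (H : set G) : Prop :=
  exists f : K -> G, [/\ {morph f : x y / x * y}, injective f & range f = H].

Definition isomorphic_to_some_BS1 (G : groupType) (H : set G) : Prop :=
  exists2 s : int, s <> 0%R & isomorphic_to (BS1 s) H.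

Record Ggraph (G : groupType) := MkGgraph {
  vertex :> choiceType;
  adj : rel vertex;
  act : G -> vertex -> vertex;
  adj_sym : symmetric adj;
  adj_irr : irreflexive adj;
  act1 : forall v, act 1 v = v;
  actM : forall g h v, act (g * h) v = act g (act h v);
  act_adj : forall g u v, adj (act g u) (act g v) = adj u v
}.

Section Graphs.
Variables (G : groupType) (T : Ggraph G).
Implicit Types (u v x : T) (e : set T) (Y : set (set T)) (g : G) (H : set G).

(* An unoriented edge is its set of endpoints. *)
Definition is_edge e : Prop := exists u v, adj u v /\ e = [set u; v].

Definition vstab v : set G := [set g | act g v = v].

Definition estab e : set G := [set g | act g @` e = e].

Definition connected : Prop :=
  forall u v, exists2 p : seq T, path (@adj _ T) u p & last u p = v.

(* [ucycle adj p] says that p is a closed walk without repeated vertex; it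
   is a circuit as soon as it has at least three vertices. *)
Definition acyclic : Prop :=
  forall p : seq T, ucycle (@adj _ T) p -> (size p <= 2)%N.

Definition without_inversions : Prop :=
  forall g u v, adj u v -> ~ (act g u = v /\ act g v = u).

Definition is_tree : Prop :=
  [/\ inhabited T, connected, acyclic & without_inversions].

Definition E_tree : Prop :=
  is_tree /\ forall e, is_edge e -> infinite_cyclic (estab e).

(* Without inversions, an element fixing an interior point of an edge fixes
   both endpoints: a subgroup fixing a point fixes a vertex. *)
Definition elliptic H : Prop := exists v, H `<=` vstab v.

(* Segments with endpoints at vertices: a longer-than-k segment of the
   geometric realisation meets the interior of at least k+1 consecutive edges,
   and, without inversions, its stabilizer fixes these edges pointwise. *)
Definition k_acylindrical (k : nat) : Prop :=
  forall u (p : seq T), path (@adj _ T) u p -> uniq (u :: p) ->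
    (k < size p)%N ->
  forall g, (forall v, v \in u :: p -> act g v = v) -> g = 1.

Definition acylindrical : Prop := exists k, k_acylindrical k.

Definition is_cylinder Y : Prop :=
  exists2 e, is_edge e &
    Y = [set e' | is_edge e' /\ commensurable (estab e) (estab e')].

Definition in_cylinder x Y : Prop := exists2 e, Y e & e x.

(* The second disjunct makes the tree of cylinders of a point a point. *)
Definition cyl_V0 : set T :=
  [set x | (exists Y Y', [/\ is_cylinder Y, is_cylinder Y', Y <> Y',
                             in_cylinder x Y & in_cylinder x Y'])
           \/ (forall y : T, y = x)].

Definition cyl_V1 : set (set (set T)) := [set Y | is_cylinder Y].

Definition act_edge g e : set T := act g @` e.

Definition act_cyl g Y : set (set T) := act_edge g @` Y.

Lemma act_edgeM g h e : act_edge (g * h) e = act_edge g (act_edge h e).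
Proof. by rewrite /act_edge image_comp; apply: eq_imagel => x _; exact: actM. Qed.

Lemma act_edge1 e : act_edge 1 e = e.
Proof.
by rewrite /act_edge -[RHS]image_id; apply: eq_imagel => x _; exact: act1.
Qed.

Lemma actK g : cancel (@act _ T g) (act g^-1).
Proof. by move=> x; rewrite -actM mulVg act1. Qed.

Lemma actVK g : cancel (@act _ T g^-1) (act g).
Proof. by move=> x; rewrite -actM mulgV act1. Qed.

Lemma act_edgeK g : cancel (act_edge g) (act_edge g^-1).
Proof. by move=> e; rewrite -act_edgeM mulVg act_edge1. Qed.

Lemma act_edgeVK g : cancel (act_edge g^-1) (act_edge g).
Proof. by move=> e; rewrite -act_edgeM mulgV act_edge1. Qed.

Lemma act_edge2 g u v : act_edge g [set u; v] = [set act g u; act g v].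
Proof. by rewrite /act_edge image_setU !image_set1. Qed.

Lemma is_edge_act g e : is_edge e -> is_edge (act_edge g e).
Proof.
move=> [u [v [uv ->]]]; exists (act g u), (act g v).
by rewrite act_adj act_edge2.
Qed.

Lemma estab_act g e : estab (act_edge g e) = conjugate_by g (estab e).
Proof.
rewrite /estab -/act_edge; apply/seteqP; split=> x.
  move=> /= xe; apply/conjugate_byE => /=; rewrite -![_ @` _]/(act_edge _ _).
  by rewrite !act_edgeM [act_edge x _]xe act_edgeK.
move=> /conjugate_byE /=; rewrite -![_ @` _]/(act_edge _ _) !act_edgeM => ee.
by rewrite -[in RHS]ee act_edgeVK.
Qed.

Lemma is_cylinder_act g Y : is_cylinder Y -> is_cylinder (act_cyl g Y).
Proof.
move=> [e ee ->]; exists (act_edge g e); first exact: is_edge_act.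
apply/seteqP; split=> [_ [e' [ee' c] <-]|e' [ee' c]].
  split; first exact: is_edge_act.
  by rewrite !estab_act; exact: commensurable_conjugate.
exists (act_edge g^-1 e'); last exact: act_edgeVK.
split; first exact: is_edge_act.
by rewrite -(act_edgeK g e) estab_act [in X in _ _ X]estab_act;
  exact: commensurable_conjugate.
Qed.

Lemma act_cylM g h Y : act_cyl (g * h) Y = act_cyl g (act_cyl h Y).
Proof.
by rewrite /act_cyl image_comp; apply: eq_imagel => e _; exact: act_edgeM.
Qed.

Lemma act_cyl1 Y : act_cyl 1 Y = Y.
Proof.
by rewrite /act_cyl -[RHS]image_id; apply: eq_imagel => e _; exact: act_edge1.
Qed.

Lemma act_cylK g : cancel (act_cyl g) (act_cyl g^-1).
Proof. by move=> Y; rewrite -act_cylM mulVg act_cyl1. Qed.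

Lemma in_cylinder_act g x Y :
  in_cylinder x Y -> in_cylinder (act g x) (act_cyl g Y).
Proof. by move=> [e Ye ex]; exists (act_edge g e); [exists e | exists x]. Qed.

Lemma cyl_V0_act g x : cyl_V0 x -> cyl_V0 (act g x).
Proof.
move=> [[Y [Y' [cY cY' YY' xY xY']]]|xT]; last first.
  by right=> y; rewrite (xT y) (xT (act g x)).
left; exists (act_cyl g Y), (act_cyl g Y'); split; do ?exact: is_cylinder_act.
- by move/(can_inj (act_cylK g)).
- exact: in_cylinder_act.
- exact: in_cylinder_act.
Qed.

Definition Tc_vertex : choiceType := (set_type cyl_V0 + set_type cyl_V1)%type.

Definition Tc_adj : rel Tc_vertex := fun a b =>
  match a, b with
  | inl x, inr Y | inr Y, inl x => `[< in_cylinder (val x) (val Y) >]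
  | _, _ => false
  end.

Definition Tc_act0 g (x : set_type cyl_V0) : set_type cyl_V0 :=
  SigSub (mem_set (cyl_V0_act g (set_mem (valP x)))).

Definition Tc_act1 g (Y : set_type cyl_V1) : set_type cyl_V1 :=
  SigSub (mem_set (is_cylinder_act g (set_mem (valP Y)))).

Definition Tc_act g (a : Tc_vertex) : Tc_vertex :=
  match a with inl x => inl (Tc_act0 g x) | inr Y => inr (Tc_act1 g Y) end.

Lemma Tc_adj_sym : symmetric Tc_adj.
Proof. by move=> [x|Y] [x'|Y']. Qed.

Lemma Tc_adj_irr : irreflexive Tc_adj.
Proof. by move=> [x|Y]. Qed.

Lemma Tc_actE1 a : Tc_act 1 a = a.
Proof.
case: a => [x|Y].
  by rewrite /=; congr inl; apply/val_inj; exact: act1.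
by rewrite /=; congr inr; apply/val_inj; exact: act_cyl1.
Qed.

Lemma Tc_actM g h a : Tc_act (g * h) a = Tc_act g (Tc_act h a).
Proof.
case: a => [x|Y].
  by rewrite /=; congr inl; apply/val_inj; exact: actM.
by rewrite /=; congr inr; apply/val_inj; exact: act_cylM.
Qed.

Lemma Tc_act_adj g a b : Tc_adj (Tc_act g a) (Tc_act g b) = Tc_adj a b.
Proof.
have E x Y : in_cylinder (act g x) (act_cyl g Y) <-> in_cylinder x Y.
  split; last exact: in_cylinder_act.
  by move/(in_cylinder_act g^-1); rewrite actK act_cylK.
by case: a b => [x|Y] [x'|Y'] //=; apply/asboolP/asboolP => /E.
Qed.

Definition Tc : Ggraph G :=
  MkGgraph Tc_adj_sym Tc_adj_irr Tc_actE1 Tc_actM Tc_act_adj.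

Definition collapsed u v : Prop :=
  adj u v /\ ~ infinite_cyclic (estab [set u; v]).

Definition collapse_rel : rel T :=
  fun u v => `[< clos_refl_sym_trans T collapsed u v >].

Lemma collapse_rel_refl : reflexive collapse_rel.
Proof. by move=> u; apply/asboolP; exact: rst_refl. Qed.

Lemma collapse_rel_sym : symmetric collapse_rel.
Proof. by move=> u v; apply/asboolP/asboolP; exact: rst_sym. Qed.

Lemma collapse_rel_trans : transitive collapse_rel.
Proof.
by move=> v u w /asboolP uv /asboolP vw; apply/asboolP; exact: rst_trans uv vw.
Qed.

Canonical collapse_equiv :=
  EquivRel collapse_rel collapse_rel_refl collapse_rel_sym collapse_rel_trans.

Definition collapse_vertex : choiceType := {eq_quot collapse_equiv}.

Definition collapse_proj (v : T) : collapse_vertex :=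
  \pi_({eq_quot collapse_equiv}) v.

Definition collapse_repr (a : collapse_vertex) : T :=
  repr (a : {eq_quot collapse_equiv}).

(* In a tree, two adjacent vertices with distinct images are joined by an
   edge which is not collapsed. *)
Definition collapse_adj : rel collapse_vertex := fun a b =>
  (a != b) &&
  `[< exists u v, [/\ collapse_proj u = a, collapse_proj v = b & adj u v] >].

Definition collapse_act g (a : collapse_vertex) : collapse_vertex :=
  collapse_proj (act g (collapse_repr a)).

Lemma collapse_projP u v :
  collapse_proj u = collapse_proj v <-> clos_refl_sym_trans T collapsed u v.
Proof.
split=> [/eqP|uv]; first by rewrite eqmodE => /asboolP.
by apply/eqP; rewrite eqmodE; exact/asboolP.
Qed.

Lemma collapse_reprK a : collapse_proj (collapse_repr a) = a.
Proof. exact: reprK. Qed.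

Lemma collapsed_act g u v : collapsed u v -> collapsed (act g u) (act g v).
Proof.
move=> [uv c]; split; first by rewrite act_adj.
rewrite -act_edge2 estab_act => /(infinite_cyclic_conjugate g^-1).
by rewrite -!estab_act act_edgeK.
Qed.

Lemma collapse_act_proj g v :
  collapse_act g (collapse_proj v) = collapse_proj (act g v).
Proof.
apply/collapse_projP; have /collapse_projP := collapse_reprK (collapse_proj v).
move: (collapse_repr _) => w; elim=> [x y xy|x|x y _|x y z _ xy _].
- exact/rst_step/collapsed_act.
- exact: rst_refl.
- exact: rst_sym.
- exact: rst_trans xy.
Qed.

Lemma collapse_adj_sym : symmetric collapse_adj.
Proof.
move=> a b; rewrite /collapse_adj eq_sym; congr (_ && _).
by apply/asboolP/asboolP => -[u [v [ua vb uv]]]; exists v, u; rewrite adj_sym.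
Qed.

Lemma collapse_adj_irr : irreflexive collapse_adj.
Proof. by move=> a; rewrite /collapse_adj eqxx. Qed.

Lemma collapse_actE1 a : collapse_act 1 a = a.
Proof. by rewrite /collapse_act act1 collapse_reprK. Qed.

Lemma collapse_actM g h a :
  collapse_act (g * h) a = collapse_act g (collapse_act h a).
Proof. by rewrite {1}/collapse_act actM -!collapse_act_proj collapse_reprK. Qed.

Lemma collapse_act_adj g a b :
  collapse_adj (collapse_act g a) (collapse_act g b) = collapse_adj a b.
Proof.
have K h : cancel (collapse_act h) (collapse_act h^-1).
  by move=> c; rewrite -collapse_actM mulVg collapse_actE1.
rewrite /collapse_adj (can_eq (K g)); congr (_ && _).
apply/asboolP/asboolP => -[u [v [ua vb uv]]]; last first.
  by exists (act g u), (act g v); rewrite -!collapse_act_proj ua vb act_adj.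
exists (act g^-1 u), (act g^-1 v).
by rewrite -!collapse_act_proj ua vb !K act_adj.
Qed.

Definition collapse : Ggraph G :=
  MkGgraph collapse_adj_sym collapse_adj_irr collapse_actE1 collapse_actM
    collapse_act_adj.

End Graphs.

Definition Tc_star (G : groupType) (T : Ggraph G) : Ggraph G := collapse (Tc T).

(* In a tree, an equivariant map between vertex sets extends to edges, an edge
   being sent to the segment joining the images of its endpoints. *)
Definition dominates (G : groupType) (T T' : Ggraph G) : Prop :=
  exists f : T -> T', forall g v, f (act g v) = act g (f v).

Definition same_deformation_space (G : groupType) (T T' : Ggraph G) : Prop :=
  forall H : set G, is_subgroup H -> (elliptic T H <-> elliptic T' H).

(* Main.v *)
(* Let [c] be a non-trivial element of an edge stabilizer.  Its cylinder [Y]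
   consists of the edges fixed by some non-zero power of [c], and the stabilizer
   of [Y] is the commensurator [W] of [<c>].  Commutative transitivity and the
   absence of torsion imply that an element of [W] normalizing a non-trivial
   cyclic subgroup of [A = C(c)] belongs to [A].  Hence, for a vertex [x] of [Y],
   either [G_x] meets [W] in an infinite cyclic subgroup of [A], or [A] meets
   [G_x] in a non-cyclic group and [W] fixes [x], which is then unique.  The
   edges [(x, Y)] of the second kind are the collapsed ones, so that vertex
   stabilizers of the collapsed tree of cylinders are vertex stabilizers of the
   tree of cylinders.

   If [W] is not elliptic, it fixes an end of [Y], and its translation length
   towards this end is a homomorphism to the integers whose kernel is cyclic or
   an increasing union of the cyclic stabilizers of the vertices of a ray.  It is
   non-zero because [G] is finitely generated, and [W] is then some [BS(1,s)]. *)

Require Import Defs.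
From mathcomp Require Import all_boot all_order all_algebra.
From mathcomp Require Import all_classical.
From mathcomp Require Import zify ring.
From Stdlib Require Import Relation_Operators.

Set Implicit Arguments.
Unset Strict Implicit.
Unset Printing Implicit Defensive.

Local Open Scope classical_set_scope.
Local Open Scope quotient_scope.
Local Open Scope group_scope.

(** * Powers and commensurability *)

(** Ends are never constructed. A filter base of vertex sets stands for an end, and its Busemann
    cocycle is a relation between pairs of vertices and integers. Two bases occur: the forward orbit
    of a vertex under a hyperbolic element of [A], and, when [A] has only elliptic elements, the
    fixed subtrees of the elements of [A]. In the first case [W] equals [A] and the parameter is 1.
    Ellipticity of the subgroups BS(1,s) in [Tc T] is independent of this dichotomy: unless both
    generators [a], [t] fix a common vertex of [T], either [a^s] or some product [a^k t^L] fixes an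
    edge, and its commensurator contains the whole subgroup. The constant 2 of acylindricity arises
    because all edges of [Tc_star T] fixed by a non-trivial [g] share the vertex given by
    [cyl_of g], while the first and third edges of a segment are disjoint. *)

Lemma int_subgroup (S : set int) : S 0%R ->
  (forall m n, S m -> S n -> S (m - n)%R) ->
  exists d : nat, S d /\ forall m, S m -> exists n : int, (m = n * d%:Z)%R.
Proof.
move=> S0 SB.
have SN m : S m -> S (- m)%R by move=> Sm; rewrite -GRing.sub0r; exact: SB.
have SD m n : S m -> S n -> S (m + n)%R.
  by move=> Sm Sn; rewrite -[n]GRing.opprK; apply: SB => //; exact: SN.
have [[d0 [d00 Sd0]]|nS] := pselect (exists d : nat, (0 < d)%N /\ S d); last first.
  exists 0%N; split=> // m Sm; exists 0%R; rewrite GRing.mul0r.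
  apply: contrapT => m0; apply: nS; exists `|m|%N; split; first by lia.
  by case: (m) Sm => n Sn //=; rewrite -[X in S X]GRing.opprK -NegzE; exact: SN.
have exd : exists d, (0 < d)%N && `[< S (Posz d) >].
  by exists d0; rewrite d00; exact/asboolP.
case: (ex_minnP exd) => d /andP[d0' /asboolP Sd] min; exists d; split=> // m Sm.
have SM (n : int) : S (n * d%:Z)%R.
  have Sn (k : nat) : S (k%:Z * d%:Z)%R.
    elim: k => [|k IH]; first by rewrite GRing.mul0r.
    by rewrite intS GRing.mulrDl GRing.mul1r; exact: SD.
  case: n => n; first exact: Sn.
  by rewrite NegzE GRing.mulNr; exact/SN/Sn.
exists (m %/ d%:Z)%Z.
have Sr : S (m %% d%:Z)%Z by exact: SB.
have [r0 rd] : ((0 <= (m %% d%:Z)%Z)%R /\ ((m %% d%:Z)%Z < d%:Z)%R).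
  by split; [rewrite modz_ge0|rewrite ltz_pmod]; lia.
rewrite {1}(divz_eq m d%:Z).
suff -> : (m %% d%:Z)%Z = 0%R by rewrite GRing.addr0.
case: (m %% d%:Z)%Z Sr r0 rd => // r Sr _ rd.
have [->//|r0] := eqVneq r 0%N.
have : (d <= r)%N by apply: min; rewrite lt0n r0; exact/asboolP.
lia.
Qed.

Lemma finite_preimage_inj (T U : Type) (A : set T) (f : T -> U) :
  (forall x y, A x -> A y -> f x = f y -> x = y) ->
  finite_set (f @` A) -> finite_set A.
Proof.
move=> fi; rewrite (eq_finite_set (inj_card_eq _)) // => x y.
by rewrite !inE => Ax Ay; exact: fi.
Qed.

Section GroupFacts.
Variable G : groupType.
Implicit Types (x y z g a b t : G) (H K : set G) (m n : int).

Lemma expgzS x m : expgz x (m + 1)%R = expgz x m * x.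
Proof.
case: m => [n|[|n]].
- by rewrite -PoszD addn1 /= expgSr.
- by rewrite /= expg1 mulVg.
- have -> : (Negz n.+1 + 1 = Negz n)%R by lia.
  by rewrite /= [x ^+ n.+2]expgS invgM mulgVK.
Qed.

Lemma expgzP x m : expgz x (m - 1)%R = expgz x m * x^-1.
Proof. by rewrite -{2}[m](GRing.subrK 1%R) expgzS mulgK. Qed.

Lemma int_ind2 (P : int -> Prop) : P 0%R -> (forall m, P m -> P (m + 1)%R) ->
  (forall m, P m -> P (m - 1)%R) -> forall m, P m.
Proof.
move=> P0 PS PB [n|n].
  by elim: n => // n IH; rewrite -addn1 PoszD; exact: PS.
elim: n => [|n IH]; first exact: (PB 0%R).
by rewrite (_ : Negz n.+1 = (Negz n - 1)%R); [exact: PB|lia].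
Qed.

Lemma expgzD x m n : expgz x (m + n)%R = expgz x m * expgz x n.
Proof.
elim/int_ind2: n => [|n IH|n IH]; first by rewrite GRing.addr0 mulg1.
  by rewrite GRing.addrA !expgzS IH mulgA.
by rewrite GRing.addrA !expgzP IH mulgA.
Qed.

Lemma expgzN x m : expgz x (- m)%R = (expgz x m)^-1.
Proof. by apply/esym/mulg1_eq; rewrite -expgzD GRing.subrr. Qed.

Lemma expgzB x m n : expgz x (m - n)%R = expgz x m * (expgz x n)^-1.
Proof. by rewrite expgzD expgzN. Qed.

Lemma expgz1 x : expgz x 1%R = x.
Proof. by []. Qed.

Lemma expgzM x m n : expgz x (m * n)%R = expgz (expgz x m) n.
Proof.
elim/int_ind2: n => [|n IH|n IH]; first by rewrite GRing.mulr0.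
  by rewrite expgzS -IH -expgzD GRing.mulrDr GRing.mulr1.
by rewrite expgzP -IH -expgzB GRing.mulrBr GRing.mulr1.
Qed.

Lemma expgz_conj g x m : g * expgz x m * g^-1 = expgz (g * x * g^-1) m.
Proof.
elim/int_ind2: m => [|m IH|m IH]; first by rewrite /= mulg1 mulgV.
  by rewrite !expgzS -IH !mulgA mulgVK.
by rewrite !expgzP -IH !invgM invgK !mulgA !mulgVK.
Qed.

Lemma expgz_of1 m : expgz (1 : G) m = 1.
Proof.
by elim/int_ind2: m => // m IH; rewrite (expgzS, expgzP) IH ?invg1 mulg1.
Qed.

Lemma commute_expgz x y m : commute x y -> commute x (expgz y m).
Proof.
case: m => n xy; rewrite /expgz; first exact: commuteX.
exact/commuteV/commuteX.
Qed.

Lemma sub1 H : is_subgroup H -> H 1. Proof. by case. Qed.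

Lemma subV H x : is_subgroup H -> H x -> H x^-1.
Proof. by move=> [H1 HV] Hx; rewrite -[x^-1]mul1g; exact: HV. Qed.

Lemma subM H x y : is_subgroup H -> H x -> H y -> H (x * y).
Proof.
by move=> sH Hx Hy; rewrite -[y]invgK; apply sH => //; exact: subV.
Qed.

Lemma subXz H x m : is_subgroup H -> H x -> H (expgz x m).
Proof.
move=> sH Hx; elim/int_ind2: m => [|m IH|m IH]; first exact: sub1.
  by rewrite expgzS; exact: subM.
by rewrite expgzP; apply sH.
Qed.

Lemma subI H K : is_subgroup H -> is_subgroup K -> is_subgroup (H `&` K).
Proof.
move=> [H1 HV] [K1 KV]; split=> // x y [Hx Kx] [Hy Ky].
by split; [exact: HV | exact: KV].
Qed.

Lemma subgroup_range_expgz x : is_subgroup (range (expgz x)).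
Proof.
split; first by exists 0%R.
by move=> _ _ [m _ <-] [n _ <-]; exists (m - n)%R; rewrite ?expgzB.
Qed.

Lemma subgroup_cyclic H : is_cyclic H -> is_subgroup H.
Proof. by move=> [x ->]; exact: subgroup_range_expgz. Qed.

Lemma subgroup_centralizer x : is_subgroup (centralizer x).
Proof.
split; first exact: commute1.
by move=> y z xy xz; apply: commuteM => //; exact: commuteV.
Qed.

Lemma subgroup_vstab (T : Ggraph G) (v : T) : is_subgroup (vstab v).
Proof.
split; first exact: act1.
by move=> x y xv yv; rewrite /vstab /= actM -{1}yv actK.
Qed.

Lemma cyclic_sub H K : is_subgroup H -> is_cyclic K -> H `<=` K -> is_cyclic H.
Proof.
move=> sH [x ->] HK.
have [||d [Hd dP]] := @int_subgroup [set m | H (expgz x m)].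
- exact: sub1.
- by move=> m n /= Hm Hn; rewrite expgzB; apply sH.
exists (expgz x d); apply/seteqP; split=> [y Hy|_ [n _ <-]]; last exact: subXz.
have [m _ my] := HK _ Hy; subst y; have [n ->] := dP m Hy.
by exists n => //; rewrite -expgzM GRing.mulrC.
Qed.

Lemma left_coset_eq H x y : is_subgroup H -> H (y^-1 * x) ->
  left_coset x H = left_coset y H.
Proof.
move=> sH.
have sub u v : H (v^-1 * u) -> left_coset u H `<=` left_coset v H.
  move=> Hxy _ [h Hh <-]; exists (v^-1 * u * h); first exact: subM.
  by rewrite !mulgA mulgV mul1g.
move=> Hxy; apply/seteqP; split; first exact: sub.
by apply: sub; have := subV sH Hxy; rewrite invgM invgK.
Qed.

Hypothesis htf : torsion_free G.

Lemma expgz_eq1 x m : x <> 1 -> expgz x m = 1 -> m = 0%R.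
Proof.
move=> x1; case: m => [[|n]|n] //= e; first by case: x1; exact: (@htf _ n.+1).
case: x1; apply: (@htf _ n.+1) => //.
by apply: invg_inj; rewrite e invg1.
Qed.

Lemma expgz_inj x : x <> 1 -> injective (expgz x).
Proof.
move=> x1 m n e; apply/eqP; rewrite -GRing.subr_eq0; apply/eqP.
by apply: (expgz_eq1 x1); rewrite expgzB e mulgV.
Qed.

Lemma infinite_cyclicP H :
  infinite_cyclic H <-> exists2 x, x <> 1 & H = range (expgz x).
Proof.
split=> [[[x ->] iH]|[x x1 ->]].
  exists x => // x1; apply: iH; rewrite x1.
  have -> : range (expgz (1 : G)) = [set 1].
    by apply/seteqP; split=> [_ [m _ <-]|_ ->];
      [exact: expgz_of1|exists 0%R].
  exact: finite_set1.
split; first by exists x.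
move=> fH; apply: infinite_nat.
apply: (@finite_preimage_inj _ _ setT (fun n : nat => expgz x n)).
  by move=> m n _ _ /(expgz_inj x1) [].
by apply: sub_finite_set fH => _ [n _ <-]; exists n%:Z%R.
Qed.

(** If the intersection is trivial, distinct elements of [H] have distinct cosets, so finite index
    would make [H] finite. Conversely, modulo a subgroup containing [x^n] with [n] non-zero, the
    powers of [x] represent at most [|n|] cosets. *)
Lemma commensurableP H K : infinite_cyclic H -> infinite_cyclic K ->
  commensurable H K <-> exists z, [/\ z <> 1, H z & K z].
Proof.
move=> iH iK.
have sH := subgroup_cyclic iH.1; have sK := subgroup_cyclic iK.1.
split=> [[fH _]|].
  apply: contrapT => nz; apply: iH.2.
  have triv z : H z -> K z -> z = 1.
    by move=> Hz Kz; apply: contrapT => z1; apply: nz; exists z.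
  apply: finite_preimage_inj fH => x y Hx Hy e.
  have : left_coset x (H `&` K) x.
    by exists 1; rewrite ?mulg1 //; exact: sub1 (subI sH sK).
  by rewrite e => -[k [Hk Kk] <-]; rewrite (triv k) // mulg1.
move=> [z [z1 Hz Kz]].
suff fi L M : is_cyclic L -> is_subgroup M -> L z -> M z -> finite_index M L.
  have zHK : (H `&` K) z by [].
  by split; apply: fi => //; [exact: iH.1|exact: subI|exact: iK.1|exact: subI].
move=> [x ->] sM [n _ zx] Mz; subst z.
have n0 : n <> 0%R by move=> n0; apply: z1; rewrite n0.
rewrite /finite_index.
apply: (@sub_finite_set _ _
  ((fun r : nat => left_coset (expgz x r) M) @` `I_(`|n|%N))).
  move=> _ [_ [i _ <-] <-].
  have i0 : (0 <= (i %% n)%Z)%R by rewrite modz_ge0; lia.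
  have il : ((i %% n)%Z < `|n|)%R by rewrite ltz_mod; lia.
  exists `|(i %% n)%Z|%N; first by rewrite /=; lia.
  rewrite (_ : Posz `|(i %% n)%Z|%N = (i %% n)%Z); last by lia.
  apply: left_coset_eq => //.
  rewrite -expgzN -expgzD {1}(divz_eq i n).
  rewrite (_ : (- _ + _)%R = ((- (i %/ n)%Z) * n)%R); last by ring.
  by rewrite GRing.mulrC expgzM; exact: subXz.
exact/finite_image/finite_II.
Qed.

Hypothesis hct : commutative_transitive G.

Lemma commute_trans x y z : y <> 1 -> commute x y -> commute y z -> commute x z.
Proof. by move=> y1 xy yz; apply: (hct y1) => //; exact: commute_sym. Qed.

Lemma commute_root g x m : x <> 1 -> m <> 0%R ->
  commute g (expgz x m) -> commute g x.
Proof.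
move=> x1 m0 gx; apply: (@commute_trans _ (expgz x m)) => //.
  by move=> /(expgz_eq1 x1).
exact/commute_sym/commute_expgz/commute_refl.
Qed.

Lemma commute_conj g b : commute g b <-> g * b * g^-1 = b.
Proof.
split=> [gb|e]; first by rewrite gb mulgK.
by rewrite /commute -{2}e mulgVK.
Qed.

(** In both cases [g * g] commutes with [b]. It also commutes with [g] and is non-trivial by
    torsion-freeness, so commuting passes through it. *)
Lemma conj_inv_commute g b : b <> 1 ->
  g * b * g^-1 = b \/ g * b * g^-1 = b^-1 -> commute g b.
Proof.
move=> b1 h; have [->|/eqP g1] := eqVneq g 1; first exact/commute_sym/commute1.
have gg1 : g * g <> 1 by move=> gg; apply: g1; apply: (@htf _ 2) => //; rewrite expg2.
apply: (@commute_trans _ (g * g)) => //; first exact/commuteM.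
apply/commute_conj; rewrite invgM.
have -> : g * g * b * (g^-1 * g^-1) = g * (g * b * g^-1) * g^-1 by rewrite !mulgA.
case: h => e; rewrite e //.
by apply: invg_inj; rewrite -{2}e !invgM !invgK !mulgA.
Qed.

(* The generator is sent to a power of itself, and so is its preimage: the
   exponent is a unit of [int]. *)
Lemma normalize_cyclic_commute g b : b <> 1 ->
  (exists m, g * b * g^-1 = expgz b m) -> (exists m, g^-1 * b * g = expgz b m) ->
  commute g b.
Proof.
move=> b1 [m em] [n en]; apply: conj_inv_commute => //.
have : expgz b (m * n)%R = b.
  by rewrite expgzM -em -expgz_conj -en !mulgA mulgV mul1g mulgK.
rewrite -[X in _ = X]expgz1 => /(expgz_inj b1) mn.
rewrite em.
have : (`|m| * `|n| == 1)%N by rewrite -abszM mn.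
rewrite muln_eq1 => /andP[/eqP m1 _].
have [->|->] : m = 1%R \/ m = (-1)%R by lia.
  by left.
by right; rewrite expgzN.
Qed.

End GroupFacts.

(** * Metric geometry of trees *)

Section TreeMetric.
Variables (G : groupType) (T : Ggraph G).
Implicit Types (u v w x y z m : T) (p q : seq T) (g : G).

Definition simple_path u p v : Prop :=
  [/\ path (@adj _ T) u p, uniq (u :: p) & last u p = v].

(** The default value 0 is never reached in a tree, where the simple path exists and is unique. *)
Definition dist u v : nat :=
  xget 0%N [set n | exists2 p, simple_path u p v & size p = n].

(** Betweenness is an equation on distances, so that most geometric steps reduce to linear
    arithmetic. *)
Definition btw x m y : Prop := (dist x m + dist m y)%N = dist x y.

Lemma simple_path_act g u p v :
  simple_path u p v -> simple_path (act g u) (map (act g) p) (act g v).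
Proof.
move=> [pp up <-]; split; last by rewrite last_map.
- rewrite path_map; by apply: sub_path pp => a b; rewrite /= act_adj.
- by rewrite -map_cons map_inj_uniq //; exact: can_inj (actK g).
Qed.

Hypothesis tT : is_tree T.

Lemma simple_path_ex u v : exists p, simple_path u p v.
Proof.
have [_ /(_ u v)[p pp <-] _ _] := tT.
by have [q pq uq _] := shortenP pp; exists q.
Qed.

(** If the first steps [x] and [y] differ, following [p] and then [q] backwards joins [x] to [y]
    away from [u]; shortened and closed up through [u], this walk is a circuit with at least three
    vertices. *)
Lemma simple_path_unique u v p q :
  simple_path u p v -> simple_path u q v -> p = q.
Proof.
have [_ _ ac _] := tT.
elim: p u q => [|x p IH] u [|y q] //.
- by move=> [_ _ /= <-] [_ /= /andP[+ _] yq]; rewrite -{1}yq mem_last.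
- by move=> [_ /= /andP[+ _] yq] [_ _ /= uv]; rewrite uv -{1}yq mem_last.
move=> [/= /andP[ux px] /andP[uxp up] xv] [/= /andP[uy qy] /andP[uyq uq] yv].
have [xy|xy] := eqVneq x y.
  by subst y; congr (_ :: _); exact: (IH x).
have pr : path (@adj _ T) x (p ++ rev (belast y q)).
  rewrite cat_path px /= xv -yv rev_path.
  by under eq_path do rewrite adj_sym.
have lr : last x (p ++ rev (belast y q)) = y.
  rewrite last_cat xv; case: (q) yv => [|z q' _] /=; first by [].
  by rewrite rev_cons last_rcons.
have ur : u \notin x :: (p ++ rev (belast y q)).
  rewrite -cat_cons mem_cat (negPf uxp) mem_rev.
  by apply: contra uyq => /mem_belast.
move: lr ur; have [r pr' ur' sr lr] := shortenP pr => ury.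
have : (size (u :: x :: r) <= 2)%N.
  apply: ac; apply/andP; split.
    by rewrite /= ux rcons_path pr' lr adj_sym uy.
  rewrite cons_uniq ur' andbT; apply: contra ury.
  by rewrite !inE => /orP[->//|/sr ->]; rewrite orbT.
by case: r lr {pr' ur' sr} => //= /eqP; rewrite (negPf xy).
Qed.

Lemma distE u p v : simple_path u p v -> dist u v = size p.
Proof.
move=> up; rewrite /dist; case: xgetP => [n _ [q uq <-]|/(_ (size p)) []].
  by rewrite (simple_path_unique up uq).
by exists p.
Qed.

Lemma dist_act g u v : dist (act g u) (act g v) = dist u v.
Proof.
have [p up] := simple_path_ex u v.
by rewrite (distE up) (distE (simple_path_act g up)) size_map.
Qed.

Lemma distxx u : dist u u = 0%N.
Proof. by rewrite (@distE u [::]). Qed.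

Lemma dist_eq0 u v : dist u v = 0%N -> u = v.
Proof.
have [p up] := simple_path_ex u v; rewrite (distE up).
by case: p up => // -[].
Qed.

Lemma dist_walk u p : path (@adj _ T) u p -> (dist u (last u p) <= size p)%N.
Proof.
move=> pp; have [q pq uq sq] := shortenP pp.
rewrite (@distE u q) //.
by apply: uniq_leq_size sq; case/andP: uq.
Qed.

Lemma dist_le_sym u v : (dist u v <= dist v u)%N.
Proof.
have [p [pp up vu]] := simple_path_ex v u.
rewrite (distE (And3 pp up vu)); rewrite -{1}vu.
have := @dist_walk (last v p) (rev (belast v p)).
rewrite rev_path size_rev size_belast.
have -> : last (last v p) (rev (belast v p)) = v.
  by case: (p) => [|z p'] //=; rewrite rev_cons last_rcons.
apply; by under eq_path do rewrite adj_sym.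
Qed.

Lemma distC u v : dist u v = dist v u.
Proof. by apply/eqP; rewrite eqn_leq !dist_le_sym. Qed.

Lemma dist_triangle u w v : (dist u v <= dist u w + dist w v)%N.
Proof.
have [p [pp up uw]] := simple_path_ex u w.
have [q [qq uq wv]] := simple_path_ex w v.
rewrite (distE (And3 pp up uw)) (distE (And3 qq uq wv)) -size_cat.
have := @dist_walk u (p ++ q); rewrite last_cat uw wv; apply.
by rewrite cat_path pp uw.
Qed.

Lemma dist1P u v : dist u v = 1%N <-> adj u v.
Proof.
split=> [|uv].
  have [p up] := simple_path_ex u v; rewrite (distE up).
  by case: p up => [|x [|]] // [/= /andP[+ _] _ <-].
rewrite (@distE u [:: v]) //; split=> //=; rewrite ?uv // inE andbT.
by apply: contraTneq uv => ->; rewrite adj_irr.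
Qed.

(** Either the geodesic from [u] to [y] avoids [z] and extends to it, or it passes through [z] and
    then ends with the edge from [z] to [y], by uniqueness of simple paths. *)
Lemma dist_adj u y z : adj y z ->
  dist u y = (dist u z).+1 \/ dist u z = (dist u y).+1.
Proof.
move=> yz; have [p [pp up uy]] := simple_path_ex u y.
have [zp|zp] := boolP (z \in u :: p); last first.
  right; rewrite (distE (And3 pp up uy)) (@distE u (rcons p z)) ?size_rcons //.
  by split; rewrite ?last_rcons // ?rcons_path ?pp ?uy // -rcons_cons rcons_uniq zp.
left; case/splitPl: zp pp up uy => p1 p2 p1z.
rewrite cat_path -cat_cons cat_uniq last_cat p1z.
move=> /andP[pp1 pp2] /and3P[u1 dis u2] zy.
have s2 : simple_path z p2 y.
  split=> //=; rewrite u2 andbT.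
  apply: contra dis => zp2; apply/hasP; exists z => //.
  by rewrite -p1z mem_last.
rewrite (@distE u (p1 ++ p2)) ?(@distE u p1) //.
- rewrite size_cat; suff -> : size p2 = 1%N by rewrite addn1.
  by rewrite -(distE s2); apply/dist1P; rewrite adj_sym.
- split; rewrite ?last_cat ?p1z // ?cat_path ?pp1 ?p1z //.
  by rewrite -cat_cons cat_uniq u1 u2 dis.
Qed.

(** Both neighbours are the last vertex but one of the simple path from [u] to [y]. *)
Lemma closer_unique u y z z' : adj y z -> adj y z' ->
  dist u y = (dist u z).+1 -> dist u y = (dist u z').+1 -> z = z'.
Proof.
have ext w : adj y w -> dist u y = (dist u w).+1 ->
    exists2 p, simple_path u (rcons p y) y & last u p = w.
  move=> yw dw; have [p [pp up uw]] := simple_path_ex u w.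
  exists p => //; split; rewrite ?last_rcons //.
    by rewrite rcons_path pp uw adj_sym.
  rewrite -rcons_cons rcons_uniq up andbT.
  apply/negP => /splitPl yp; case: yp pp up uw dw => p1 p2 p1y.
  rewrite cat_path -cat_cons cat_uniq last_cat p1y.
  move=> /andP[pp1 pp2] /and3P[u1 dis u2] zy.
  rewrite (@distE u (p1 ++ p2) w).
    by rewrite (@distE u p1 y) // size_cat; lia.
  split; rewrite ?last_cat ?p1y // ?cat_path ?pp1 ?p1y //.
  by rewrite -cat_cons cat_uniq u1 u2 dis.
move=> yz yz' dz dz'.
have [p sp <-] := ext _ yz dz; have [q sq <-] := ext _ yz' dz'.
by have /rcons_inj[->] := simple_path_unique sp sq.
Qed.

Lemma closer_ex u y : u <> y -> exists2 z, adj y z & dist u y = (dist u z).+1.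
Proof.
move=> uy; have [p [pp up lp]] := simple_path_ex u y.
case/lastP: p pp up lp => [|p y'] // pp up; rewrite last_rcons => yE.
subst y'; move: pp up; rewrite rcons_path -rcons_cons rcons_uniq.
move=> /andP[pp ly] /andP[yp up].
exists (last u p); first by rewrite adj_sym.
rewrite (@distE u (rcons p y)) ?(@distE u p) ?size_rcons //.
by split; rewrite ?last_rcons ?rcons_path ?pp // -rcons_cons rcons_uniq yp.
Qed.

Lemma btwC x m y : btw x m y -> btw y m x.
Proof. by rewrite /btw !(distC _ y) (distC m x) addnC. Qed.

Lemma btw_act g x m y : btw x m y -> btw (act g x) (act g m) (act g y).
Proof. by rewrite /btw !dist_act. Qed.

Lemma btwxx x m : btw x m x -> m = x.
Proof. by rewrite /btw distxx => e; apply: dist_eq0; rewrite distC; lia. Qed.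

Lemma btwl x y : btw x x y. Proof. by rewrite /btw distxx. Qed.
Lemma btwr x y : btw x y y. Proof. by rewrite /btw distxx addn0. Qed.

Lemma btw_trans x m y n : btw x m y -> btw x n m -> btw x n y /\ btw n m y.
Proof.
rewrite /btw; have := dist_triangle n m y; have := dist_triangle x n y; lia.
Qed.

Lemma btw_step x y : x <> y ->
  exists z, [/\ adj x z, btw x z y & dist x y = (dist z y).+1].
Proof.
move=> xy; have [|z xz] := @closer_ex y x; first exact/nesym.
rewrite ![dist y _]distC => e; exists z; split => //.
by rewrite /btw e; have /dist1P -> := xz.
Qed.

(* Induction on [d(z, w)]: the last step of a geodesic from [y] to [w] cannot
   move closer to [x], because the vertex before it already has another
   neighbour closer to [x], on the way back to [y]. *)
Lemma btw_glue x y z w : y <> z -> btw x y z -> btw y z w -> btw x z w.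
Proof.
move=> nyz; have [n le_n] := ubnP (dist z w).
elim: n w le_n => // n IH w le_n xyz yzw.
have [->|/eqP zw] := eqVneq z w; first exact: btwr.
have [w' ww' zw'] := closer_ex zw.
have /dist1P w'w := ww'.
have yzw' : btw y z w'.
  move: yzw; rewrite /btw.
  have := dist_triangle y z w'; have := dist_triangle y w' w.
  rewrite (distC w' w); lia.
have xzw' : btw x z w' by apply: IH => //; lia.
have [e|e] := dist_adj x ww'; first by move: xzw'; rewrite /btw; lia.
have nyw' : y <> w'.
  move=> yw'; subst w'; move: yzw'; rewrite /btw distxx => h.
  by apply: nyz; apply: dist_eq0; lia.
have [v w'v yv] := closer_ex nyw'.
suff vw : v = w by subst v; move: yzw yzw'; rewrite /btw; lia.
have yw : dist y w = (dist y w').+1 by move: yzw yzw'; rewrite /btw; lia.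
apply: (@closer_unique x w') => //; first by rewrite adj_sym.
have := dist_triangle x y v; have := dist_triangle x v w'.
have /dist1P := w'v; rewrite distC => ->.
by move: xyz xzw' yzw'; rewrite /btw; lia.
Qed.

(** Deleting [m] separates [x] from [y], so [z] is cut off from at least one of them. Otherwise the
    neighbours of [m] towards [x] and towards [y] would both be its unique neighbour closer to
    [z]. *)
Lemma btw_split x y m z : btw x m y -> btw x m z \/ btw z m y.
Proof.
move=> xmy.
have [->|/eqP mx] := eqVneq m x; first by left; exact: btwl.
have [->|/eqP my] := eqVneq m y; first by right; exact: btwr.
have [m1 [a1 b1 d1]] := btw_step mx; have [m2 [a2 b2 d2]] := btw_step my.
have glue w m' : m' <> m -> btw m m' w -> dist z m' = (dist z m).+1 ->
    adj m m' -> btw w m z.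
  move=> nm bm dm am; apply: (@btw_glue w m' m z) => //; first exact: btwC.
  by rewrite /btw (distC m' z) dm (distC m z) distC; have /dist1P -> := am.
have nm1 : m1 <> m by move=> e; move: a1; rewrite e adj_irr.
have nm2 : m2 <> m by move=> e; move: a2; rewrite e adj_irr.
have [e1|e1] := dist_adj z a1; last by left; apply: glue e1 a1.
have [e2|e2] := dist_adj z a2; last by right; apply: btwC; apply: glue e2 a2.
have m12 := closer_unique a1 a2 e1 e2; subst m2.
have := dist_triangle x m1 y; move: xmy; rewrite /btw (distC x m1).
rewrite (distC x m); lia.
Qed.

Lemma btw_unique x m m' y : btw x m y -> btw x m' y ->
  dist x m = dist x m' -> m = m'.
Proof.
move=> b b' e; have [|] := btw_split m' b; rewrite /btw => h.
  by apply: dist_eq0; lia.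
by apply: dist_eq0; rewrite distC; move: b b'; rewrite /btw; lia.
Qed.

(** * Convex subsets, projections and medians *)

Definition convex (C : set T) : Prop :=
  forall x y m, C x -> C y -> btw x m y -> C m.

(** The gate is a point of [C] nearest to [z]: the first step from it towards [u] stays in [C],
    hence moves away from [z], and the two geodesics glue. *)
Lemma gate (C : set T) z : convex C -> C !=set0 ->
  exists2 p, C p & forall u, C u -> btw z p u.
Proof.
move=> cC [x0 Cx0].
have exn : exists n, `[< exists2 p, C p & dist z p = n >].
  by exists (dist z x0); apply/asboolP; exists x0.
case: (ex_minnP exn) => n /asboolP[p Cp <-] min.
exists p => // u Cu; have [->|/eqP pu] := eqVneq p u; first exact: btwr.
have [m [am bm dm]] := btw_step pu.
have Cm : C m by exact: cC bm.
have [e|e] := dist_adj z am.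
  suff : (dist z p <= dist z m)%N by lia.
  by apply: min; apply/asboolP; exists m.
apply: btwC; apply: (@btw_glue u m p z) => //.
- by move=> e'; move: am; rewrite e' adj_irr.
- exact: btwC.
- by rewrite /btw !(distC _ z) e (distC m); have /dist1P -> := am; lia.
Qed.

Lemma convex_btw x y : convex [set m | btw x m y].
Proof.
move=> a b m /= xay xby amb.
have [|h] := btw_split x amb.
  by move/btwC => xma; have [] := btw_trans xay xma.
by have [] := btw_trans xby h.
Qed.

(** The median is the projection of [z] to the segment from [x] to [y]. *)
Lemma median x y z : exists m, [/\ btw x m y, btw x m z & btw y m z].
Proof.
have [|m xmy h] := @gate _ z (@convex_btw x y).
  by exists x; exact: btwl.
exists m; split=> //; apply: btwC; apply: h; [exact: btwl|exact: btwr].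
Qed.

Lemma btw_at x y n : (n <= dist x y)%N -> exists2 m, btw x m y & dist x m = n.
Proof.
elim: n => [_|n IH ln]; first by exists x; [exact: btwl|rewrite distxx].
have [m bm dm] := IH (ltnW ln).
have my : m <> y by move=> e; subst m; lia.
have [m' [am bm' dm']] := btw_step my.
have bb : btw x m' y.
  by apply: (@convex_btw x y m y) bm' => //; exact: btwr.
by exists m' => //; move: bm bb; rewrite /btw; lia.
Qed.

(** * Elliptic and hyperbolic isometries *)

Definition fix_set g : set T := [set x | act g x = x].

Lemma convex_fix g : convex (fix_set g).
Proof.
move=> x y m gx gy xmy.
have := btw_act g xmy; rewrite gx gy => b.
apply: (btw_unique b xmy).
by rewrite -{1}gx dist_act.
Qed.

Lemma dist_inversion g x y : adj x y -> act g x = y -> act g y <> x.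
Proof. by have [_ _ _ ni] := tT; move=> xy gx gy; apply: (ni g x y). Qed.

(* The centre of the bounded set [S]: two vertices of minimal eccentricity at
   distance at least two would have a vertex between them of smaller
   eccentricity, and an edge of centres cannot be inverted. *)
Lemma bounded_fix (H : set G) (S : set T) k : is_subgroup H -> S !=set0 ->
  (forall g x, H g -> S x -> S (act g x)) ->
  (forall x y, S x -> S y -> (dist x y <= k)%N) ->
  elliptic T H.
Proof.
move=> [H1 HV] [x0 Sx0] HS bS.
pose ecc x n := forall y, S y -> (dist x y <= n)%N.
have exn : exists n, `[< exists x, ecc x n >].
  by exists k; apply/asboolP; exists x0 => y Sy; exact: bS.
case: (ex_minnP exn) => n /asboolP[x ex] min.
have inv g z : H g -> ecc z n -> ecc (act g z) n.
  move=> Hg ez y Sy; rewrite -(dist_act g^-1) actK; apply: ez.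
  by apply: HS => //; rewrite -[g^-1]mul1g; exact: HV.
have near1 a b : ecc a n -> ecc b n -> (dist a b <= 1)%N.
  move=> ea eb; rewrite leqNgt; apply/negP => ab.
  have [m am dm] := btw_at (ltnW ab).
  have em : ecc m n.-1.
    move=> y Sy; have := ea _ Sy; have := eb _ Sy.
    by have [|] := btw_split y am; move: am (distC y b) (distC y m); rewrite /btw; lia.
  have : (n <= n.-1)%N by apply: min; apply/asboolP; exists m.
  have := ea _ Sx0; have := eb _ Sx0; have := dist_triangle a x0 b.
  by rewrite (distC x0 b); lia.
have adj1 a b : ecc a n -> ecc b n -> a <> b -> adj a b.
  move=> ea eb ab; apply/dist1P; have := near1 _ _ ea eb.
  by case e : (dist a b) => [|[|]] // _; case: ab; exact: dist_eq0.
apply: contrapT => nell.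
have [h Hh hx] : exists2 h, H h & act h x <> x.
  apply: contrapT => nh; apply: nell; exists x => g Hg.
  by apply: contrapT => gx; apply: nh; exists g.
have ehx := inv _ _ Hh ex; have ehhx := inv _ _ Hh ehx.
have xhx := adj1 _ _ ex ehx (nesym hx).
have hh : act h (act h x) <> x by apply: dist_inversion xhx _.
have hhx : act h (act h x) <> act h x by move/(can_inj (actK h)).
have := dist_adj (act h (act h x)) xhx.
have /dist1P -> := adj1 _ _ ehhx ex hh.
by have /dist1P -> := adj1 _ _ ehhx ehx hhx; case.
Qed.

(** The vertex is the median [m] of [x], [act g x] and [v]: both [m] and [act g m] lie on the
    segment from [act g x] to [v], at the same distance from its origin. *)
Lemma elliptic_mid g v x : act g v = v ->
  exists2 m, btw x m (act g x) & act g m = m.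
Proof.
move=> gv; have [m [xm xv gxv]] := median x (act g x) v.
exists m => //.
have gm := btw_act g xv; rewrite gv in gm.
apply: (btw_unique gm gxv); rewrite dist_act.
have := dist_act g x v; rewrite gv; move: xv gxv; rewrite /btw; lia.
Qed.

(** By commutation [a] fixes [x] and [act b x], hence also the vertex between them that [b]
    fixes. *)
Lemma commuting_fix a b x y : commute a b -> act a x = x -> act b y = y ->
  exists2 m : T, act a m = m & act b m = m.
Proof.
move=> ab ax bY; have [m xm bm] := elliptic_mid x bY; exists m => //.
by apply: convex_fix xm => //; rewrite /fix_set /= -actM ab actM ax.
Qed.

(** The vertex [p] has minimal displacement [L]. If the path through [p], [act g p],
    [act g (act g p)] backtracked, the first vertex [m] after [p] would have smaller displacement,
    or [g] would invert an edge. Without backtracking the translates of the first segment glue into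
    a geodesic. *)
Lemma hyperbolic_axis g : (forall v, act g v <> v) ->
  exists (x : T) L, (0 < L)%N /\ forall n, dist x (act (g ^+ n) x) = (n * L)%N.
Proof.
move=> ng.
have exn : exists n, `[< exists x, dist x (act g x) = n >].
  have [[x0] _ _ _] := tT.
  by exists (dist x0 (act g x0)); apply/asboolP; exists x0.
case: (ex_minnP exn) => L /asboolP[p pL] min.
have L0 : (0 < L)%N.
  rewrite lt0n; apply/eqP => L0; apply: (ng p); apply/esym/dist_eq0.
  by rewrite pL.
have {}min x : (L <= dist x (act g x))%N.
  by apply: min; apply/asboolP; exists x.
have b2 : btw p (act g p) (act g (act g p)).
  have [|m [am bm dm]] := @btw_step p (act g p); first exact/nesym/ng.
  have agm : adj (act g p) (act g m) by rewrite act_adj.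
  have bgm := btw_act g bm.
  have /dist1P m1 := am; have /dist1P gm1 := agm.
  have [e|e] := dist_adj p agm.
    have gm := min m; exfalso.
    have [h|h] := btw_split (act g m) bm; first by move: h e; rewrite /btw; lia.
    have mp : m = act g p.
      by apply: dist_eq0; move: h gm1; rewrite /btw !(distC (act g m)); lia.
    have gmp : act g m = p by apply/esym/dist_eq0; move: dm e; rewrite mp distxx; lia.
    by apply: (dist_inversion am) gmp; rewrite mp.
  have b1 : btw p (act g p) (act g m) by rewrite /btw e gm1 addn1.
  have ngm : act g p <> act g m by move=> h; move: gm1; rewrite h distxx.
  by have := btw_glue ngm b1 bgm; move: b1 bgm; rewrite /btw; lia.
exists p, L; split=> //.
have step n : btw p (act (g ^+ n) p) (act (g ^+ n.+1) p).
  elim: n => [|n IH]; first by rewrite expg0 act1; exact: btwl.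
  apply: (@btw_glue p (act (g ^+ n) p)) => //.
    by rewrite expgSr actM => /(can_inj (actK _)) /esym; exact: ng.
  by rewrite (expgSr g n.+1) (expgSr g n) !actM; exact: btw_act.
elim=> [|n IH]; first by rewrite expg0 act1 distxx.
by have := step n; rewrite /btw IH expgSr actM dist_act pL; lia.
Qed.

(* [F] is a filter base standing for an end of the tree, and [horo y z k] says
   that the Busemann cocycle of this end takes the value [k] at [(y, z)]. *)
Section Horofunction.
Variable F : set (set T).
Hypothesis F0 : F !=set0.
Hypothesis FN : forall A, F A -> A !=set0.
Hypothesis FD : forall A B, F A -> F B -> exists2 C, F C & C `<=` A `&` B.

Definition horo y z (k : int) : Prop :=
  exists2 A, F A & forall u, A u -> ((dist y u)%:Z = (dist z u)%:Z + k)%R.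

Lemma horo_unique y z k l : horo y z k -> horo y z l -> k = l.
Proof.
move=> [A FA hA] [B FB hB]; have [C FC CAB] := FD FA FB.
have [u Cu] := FN FC; have [/hA + /hB] := CAB _ Cu; lia.
Qed.

Lemma horo_refl y : horo y y 0%R.
Proof. by have [A FA] := F0; exists A => // u _; rewrite GRing.addr0. Qed.

Lemma horo_add y z w k l : horo y z k -> horo z w l -> horo y w (k + l)%R.
Proof.
move=> [A FA hA] [B FB hB]; have [C FC CAB] := FD FA FB.
by exists C => // u /CAB[/hA + /hB]; lia.
Qed.

Lemma horo_sym y z k : horo y z k -> horo z y (- k)%R.
Proof. by move=> [A FA hA]; exists A => // u /hA; lia. Qed.

Hypothesis FA : forall y z, adj y z -> exists k, horo y z k.

Lemma horo_total y z : exists k, horo y z k.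
Proof.
have [n le_n] := ubnP (dist y z); elim: n y le_n => // n IH y le_n.
have [->|/eqP yz] := eqVneq y z; first by exists 0%R; exact: horo_refl.
have [m [ym _ dm]] := btw_step yz; have [k yk] := FA ym.
by have [|l ml] := IH m; [lia | exists (k + l)%R; exact: horo_add ml].
Qed.

Lemma horo_inv_adj g :
  (forall y z k, adj y z -> horo y z k -> horo (act g y) (act g z) k) ->
  forall y z k, horo y z k -> horo (act g y) (act g z) k.
Proof.
move=> ga y z; have [n le_n] := ubnP (dist y z).
elim: n y le_n => // n IH y le_n k yzk.
have [e|/eqP yz] := eqVneq y z.
  subst y; rewrite (horo_unique yzk (horo_refl z)); exact: horo_refl.
have [m [ym _ dm]] := btw_step yz.
have [k1 ymk] := FA ym; have [k2 mzk] := horo_total m z.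
rewrite (horo_unique yzk (horo_add ymk mzk)).
by apply: horo_add (ga _ _ _ ym ymk) (IH _ _ _ mzk); lia.
Qed.

(** With this sign, [k] is negative when [g] moves towards the end. *)
Definition shift g (k : int) : Prop := forall y, horo (act g y) y k.

Lemma shift_unique g k l : shift g k -> shift g l -> k = l.
Proof. by have [[x0] _ _ _] := tT => /(_ x0) + /(_ x0); exact: horo_unique. Qed.

Lemma shift1 : shift 1 0%R.
Proof. by move=> y; rewrite act1; exact: horo_refl. Qed.

Lemma shiftM g h k l : shift g k -> shift h l -> shift (g * h) (k + l)%R.
Proof. by move=> gk hl y; rewrite actM; exact: horo_add (gk _) (hl _). Qed.

Lemma shiftV g k : shift g k -> shift g^-1 (- k)%R.
Proof. by move=> gk y; have := gk (act g^-1 y); rewrite actVK => /horo_sym. Qed.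

Lemma shift_expgz g k n : shift g k -> shift (expgz g n) (n * k)%R.
Proof.
move=> gk; elim/int_ind2: n => [|n IH|n IH].
- by rewrite GRing.mul0r; exact: shift1.
- by rewrite expgzS GRing.mulrDl GRing.mul1r; exact: shiftM.
- by rewrite expgzP GRing.mulrBl GRing.mul1r; apply: shiftM => //; exact: shiftV.
Qed.

Lemma shift_fix g k x : shift g k -> act g x = x -> k = 0%R.
Proof.
by move=> /(_ x) + gx; rewrite gx => /horo_unique; apply; exact: horo_refl.
Qed.

Lemma shift_ex g : (forall y z k, horo y z k -> horo (act g y) (act g z) k) ->
  exists k, shift g k.
Proof.
move=> gi; have [[x0] _ _ _] := tT; have [k k0] := horo_total (act g x0) x0.
exists k => y; have [l l0] := horo_total y x0.
have := horo_add (horo_add (gi _ _ _ l0) k0) (horo_sym l0).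
by rewrite GRing.addrAC GRing.subrr GRing.add0r.
Qed.

(** The rays from [y] and [act g y] to the end merge at [m], whose position is determined by [d] and
    so is the same for all [u]. Both [m] and [act g m] lie on the ray from [act g y], the latter [d]
    further on. For [d = 0] this gives a fixed vertex. *)
Lemma shift_axis g (d : nat) y :
  (forall y z k, horo y z k -> horo (act g y) (act g z) k) ->
  shift g (- d%:Z)%R ->
  exists m, [/\ btw y m (act g y), dist m (act g m) = d &
    exists2 A, F A & forall u, A u -> btw m (act g m) u].
Proof.
move=> gi /(_ y)[A fA hA]; have [u0 Au0] := FN fA.
have med u : A u -> exists m, [/\ btw y m (act g y), btw y m u,
    btw (act g y) m u & (dist y m + dist y m)%N = (dist y (act g y) + d)%N].
  move=> /hA hu; have [m [ym yu gu]] := median y (act g y) u; exists m.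
  split=> //; move: ym yu gu hu; rewrite /btw (distC m (act g y)).
  rewrite (distC _ m); lia.
have [m [ym _ _ dm]] := med _ Au0.
have bm u : A u -> btw y m u /\ btw (act g y) m u.
  move=> /med[m' [ym' yu gu dm']].
  by have -> : m = m' by apply: (btw_unique ym ym'); lia.
have hm : horo y m (dist y m)%:Z.
  by exists A => // u /bm[+ _]; rewrite /btw; lia.
have [B fB hB] := gi _ _ _ hm; have [C fC CAB] := FD fA fB.
have key u : C u -> btw m (act g m) u /\ dist m (act g m) = d.
  move=> /CAB[Au /hB hu]; have [bu gu] := bm _ Au; have du := hA _ Au.
  have gm := dist_act g y m.
  have [h|h] := btw_split (act g m) gu.
    move: h gu hu du ym bu; rewrite /btw (distC m (act g y)) ?(distC (act g y) m).
    by rewrite gm; lia.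
  move: h gu hu du ym bu; rewrite /btw (distC m (act g y)) ?(distC (act g y) m).
  by rewrite (distC (act g m) m); lia.
exists m; split=> //; first by have [u1 /key[]] := FN fC.
by exists C => // u /key[].
Qed.

End Horofunction.

Lemma eventually_const (f : nat -> nat) b :
  (forall n, (f n <= f n.+1)%N) -> (forall n, (f n <= b)%N) ->
  exists N, forall n, (N <= n)%N -> f n = f N.
Proof.
move=> fS fb.
have exf : exists k, `[< exists n, f n = k >].
  by exists (f 0%N); apply/asboolP; exists 0%N.
case: (@ex_maxnP _ b exf) => [k /asboolP[n <-] //|k /asboolP[N <-] max].
exists N => n Nn; apply/eqP; rewrite eqn_leq; apply/andP; split.
  by apply: max; apply/asboolP; exists n.
by have := @homo_leq _ f leq leqnn leq_trans fS _ _ Nn.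
Qed.

(** * The attracting end of a hyperbolic element *)

Section Axis.
Variables (h : G) (p : T) (L : nat).
Hypothesis L0 : (0 < L)%N.
Hypothesis hL : forall n, dist p (act (h ^+ n) p) = (n * L)%N.

Definition axis_tails : set (set T) :=
  [set A | exists n, A = [set u | exists2 m, (n <= m)%N & u = act (h ^+ m) p]].

Lemma axis_tails0 : axis_tails !=set0.
Proof. by eexists; exists 0%N. Qed.

Lemma axis_tailsN A : axis_tails A -> A !=set0.
Proof. by move=> [n ->]; exists (act (h ^+ n) p), n. Qed.

Lemma axis_tailsD A B : axis_tails A -> axis_tails B ->
  exists2 C, axis_tails C & C `<=` A `&` B.
Proof.
move=> [n ->] [m ->].
exists [set u | exists2 k, (maxn n m <= k)%N & u = act (h ^+ k) p].
  by exists (maxn n m).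
by move=> _ [k + ->]; rewrite geq_max => /andP[nk mk]; split; exists k.
Qed.

Lemma axis_horoP y z k (N : nat) :
  (forall n, (N <= n)%N ->
    ((dist y (act (h ^+ n) p))%:Z = (dist z (act (h ^+ n) p))%:Z + k)%R) ->
  horo axis_tails y z k.
Proof.
move=> H; exists [set u | exists2 m, (N <= m)%N & u = act (h ^+ m) p].
  by exists N.
by move=> _ [n Nn ->]; exact: H.
Qed.

(** The defect [dist y p + n * L - dist y (act (h ^+ n) p)] is non-decreasing in [n] and bounded by
    twice [dist y p], hence eventually constant. This makes the Busemann cocycle of the axis defined
    everywhere. *)
Lemma axis_dist_eventually y : exists N c, forall n, (N <= n)%N ->
  (dist y (act (h ^+ n) p) + c = dist y p + n * L)%N.
Proof.
pose f n := (dist y p + n * L - dist y (act (h ^+ n) p))%N.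
have tri n : (dist y (act (h ^+ n) p) <= dist y p + n * L)%N.
  by rewrite -hL; exact: dist_triangle.
have [n|n|N HN] := @eventually_const f (dist y p + dist y p).
- rewrite /f; have := tri n; have := tri n.+1.
  have := dist_triangle y (act (h ^+ n) p) (act (h ^+ n.+1) p).
  rewrite expgSr actM dist_act; have := hL 1; rewrite expg1 => ->; lia.
- rewrite /f; have := dist_triangle p y (act (h ^+ n) p).
  rewrite hL (distC p y); lia.
exists N, (f N) => n Nn; rewrite -(HN _ Nn) /f; have := tri n; lia.
Qed.

Lemma axis_tailsA y z : adj y z -> exists k, horo axis_tails y z k.
Proof.
move=> _; have [N [c Hy]] := axis_dist_eventually y.
have [M [d Hz]] := axis_dist_eventually z.
exists ((dist y p)%:Z - c%:Z - (dist z p)%:Z + d%:Z)%R.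
apply: (@axis_horoP _ _ _ (maxn N M)) => n; rewrite geq_max => /andP[Nn Mn].
have := Hy _ Nn; have := Hz _ Mn; lia.
Qed.

Lemma commute_act_pow g n x : commute g h ->
  act g (act (h ^+ n) x) = act (h ^+ n) (act g x).
Proof. by move=> gh; rewrite -!actM; congr act; exact: commuteX. Qed.

(* Translating a ray by an element commuting with [h] moves its points by a
   bounded amount, which does not change the end of the ray. *)
Lemma axis_horo_inv g : commute g h -> forall y z k,
  horo axis_tails y z k -> horo axis_tails (act g y) (act g z) k.
Proof.
move=> gh; apply: (horo_inv_adj axis_tails0 axis_tailsN axis_tailsD axis_tailsA).
move=> y z k yz [_ [N ->] Hk].
pose D := dist p (act g p).
apply: (@axis_horoP _ _ _ (N + D + dist y p + dist z p).+2) => n nN.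
have far x : (n <= dist x p + dist x (act (h ^+ n) p))%N.
  have := dist_triangle p x (act (h ^+ n) p); rewrite hL (distC p x).
  have : (n <= n * L)%N by rewrite leq_pmulr.
  lia.
have close : dist (act (h ^+ n) p) (act g^-1 (act (h ^+ n) p)) = D.
  rewrite -(dist_act g) actVK commute_act_pow // dist_act distC; exact: erefl.
have Hu : ((dist y (act (h ^+ n) p))%:Z = (dist z (act (h ^+ n) p))%:Z + k)%R.
  by apply: Hk; exists n => //; lia.
have actg x : dist (act g x) (act (h ^+ n) p) = dist x (act g^-1 (act (h ^+ n) p)).
  by rewrite -(dist_act g x) actVK.
rewrite !actg.
move: (act (h ^+ n) p) (act g^-1 (act (h ^+ n) p)) far close Hu => u v far uvD Hu.
have fy := far y; have fz := far z; have /dist1P yz1 := yz.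
have nyz : y <> z by move=> e; move: yz1; rewrite e distxx.
have zy1 := distC z y.
have glue a b : dist a b = 1%N -> a <> b -> dist u b = (dist u a).+1 ->
    dist v a = (dist v b).+1 -> (dist u b <= D)%N.
  move=> ab nab du dv.
  have := @btw_glue u a b v nab; rewrite /btw -uvD (distC b v) (distC a v); lia.
have := glue _ _ yz1 nyz; have := glue _ _ (etrans zy1 yz1) (nesym nyz).
move: (dist_adj u yz) (dist_adj v yz) fy fz Hu; rewrite !(distC u) !(distC v); lia.
Qed.

Lemma axis_shift_self : shift axis_tails h (- L%:Z)%R.
Proof.
have [k hk] := shift_ex axis_tails0 axis_tailsD axis_tailsA
  (axis_horo_inv (commute_refl h)).
suff -> : (- L%:Z)%R = k by [].
apply: horo_unique axis_tailsN axis_tailsD _ _ _ _ _ (hk p).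
apply: (@axis_horoP _ _ _ 1) => -[//|n] _.
by rewrite {1}expgS actM dist_act !hL mulSn; lia.
Qed.

(** Take [v] and [u] far out on the axis, on either side of [p]. As [g] moves each by [D] only, too
    little to pass [p], both [p] and [act g p] lie between [act g v] and [act g u]; zero shift puts
    them at the same distance from [act g u]. *)
Lemma axis_shift0_fix g : commute g h -> shift axis_tails g 0%R -> act g p = p.
Proof.
move=> gh /shiftV /(_ p)[_ [N ->] HN].
pose D := dist p (act g p); pose n := (N + D).+1.
have nL : (D < n * L)%N.
  by apply: (@leq_trans n); [rewrite /n; lia|rewrite leq_pmulr].
pose u := act (h ^+ n) p; pose v := act (h ^- n) p.
have vp : dist v p = (n * L)%N by rewrite -(dist_act (h ^+ n)) /v actVK hL.
have pu : dist p u = (n * L)%N by rewrite hL.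
have vu : btw v p u.
  rewrite /btw vp pu -[RHS](dist_act (h ^+ n)) /v actVK /u -actM -expgnDr hL; lia.
have gu : dist u (act g u) = D by rewrite /u commute_act_pow // dist_act.
have gv : dist v (act g v) = D.
  by rewrite -(dist_act (h ^+ n)) -commute_act_pow // /v actVK.
have b1 : btw (act g v) p u.
  have [h1|//] := btw_split (act g v) vu; move: h1; rewrite /btw gv vp; lia.
have b2 : btw (act g v) p (act g u).
  have [//|h1] := btw_split (act g u) b1; move: h1.
  by rewrite /btw (distC (act g u) u) gu pu; lia.
have b3 := btw_act g vu.
apply/esym/(btw_unique b2 b3).
have : dist p (act g u) = dist p u.
  have /HN : exists2 m, (N <= m)%N & u = act (h ^+ m) p.
    by exists n => //; rewrite /n; lia.
  by rewrite -(dist_act g (act g^-1 p)) actVK; lia.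
have := dist_act g p u; move: b2 b3; rewrite /btw; lia.
Qed.

End Axis.

End TreeMetric.

(** * Baumslag-Solitar groups *)

Section Evaluation.
Variables (X : choiceType) (R : set (seq (X * bool))).
Variables (M : Type) (op : M -> M -> M) (e : M) (phi : X * bool -> M).
Hypotheses (opA : associative op) (op1 : left_id e op) (opr1 : right_id e op).
Hypothesis phiV : forall x b, op (phi (x, b)) (phi (x, ~~ b)) = e.

(** The target is a monoid in which letters have inverses, so that words can be evaluated in a group
    as well as in the self-maps of a set. *)
Definition eval_word (w : seq (X * bool)) : M :=
  foldr (fun l acc => op (phi l) acc) e w.

Hypothesis phiR : forall r, R r -> eval_word r = e.

Lemma eval_word_cat u v : eval_word (u ++ v) = op (eval_word u) (eval_word v).
Proof. by elim: u => [|l u IH] /=; rewrite ?op1 // IH opA. Qed.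

Lemma eval_word_pres u v : pres_eq R u v -> eval_word u = eval_word v.
Proof.
elim=> //.
- by move=> u1 u2 u3 _ -> _ ->.
- by move=> u1 u2 w1 w2 _ e1 _ e2; rewrite !eval_word_cat e1 e2.
- by move=> x b /=; rewrite opr1.
Qed.

Definition eval_pres (u : presented R) : M := eval_word (repr u).

Lemma eval_pres_pi w : eval_pres (\pi_(presented R) w) = eval_word w.
Proof. exact/eval_word_pres/pres_repr. Qed.

Lemma eval_presM u v : eval_pres (u * v) = op (eval_pres u) (eval_pres v).
Proof. by rewrite -eval_word_cat; exact: eval_pres_pi. Qed.

End Evaluation.

Section PresentedInduction.
Variables (X : choiceType) (R : set (seq (X * bool))).

Definition pres_gen (x : X) : presented R := \pi_(presented R) [:: (x, true)].

Lemma pres_piM u v :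
  (\pi_(presented R) u : presented R) * \pi_(presented R) v =
  \pi_(presented R) (u ++ v).
Proof. by apply/pres_piP; apply: pres_cat; exact: pres_repr. Qed.

Lemma pres_genV x : (pres_gen x)^-1 = \pi_(presented R) [:: (x, false)].
Proof. by apply: mulg1_eq; rewrite pres_piM; apply/pres_piP/(pres_cancel R x true). Qed.

Lemma pres_ind (P : presented R -> Prop) : P 1 ->
  (forall x u, P u -> P (pres_gen x * u) /\ P ((pres_gen x)^-1 * u)) ->
  forall u, P u.
Proof.
move=> P1 Pg u; rewrite -[u]reprK; elim: (repr u) => [|[x b] w IH] //.
have [Pt Pf] := Pg x _ IH.
by move: Pt Pf; rewrite pres_genV !pres_piM; case: b.
Qed.

End PresentedInduction.

(** * Normal forms in BS(1,s) *)

Section NormalForm.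
Variables (G : groupType) (t a : G) (s : int).

(** Positive powers of [t] move to the right past powers of [a], at the cost of multiplying
    exponents by powers of [s]; negative powers move to the left. *)
Definition BS_form (x : G) : Prop :=
  exists i j : nat, exists m : int, x = t ^- i * expgz a m * t ^+ j.

Hypothesis ta : t * a * t^-1 = expgz a s.

Lemma BS_pow_conj (n : nat) m :
  t ^+ n * expgz a m = expgz a (m * s ^+ n)%R * t ^+ n.
Proof.
have step k : t * expgz a k = expgz a (k * s)%R * t.
  by rewrite GRing.mulrC expgzM -ta -expgz_conj mulgVK.
elim: n m => [|n IH] m; first by rewrite mulg1 mul1g GRing.expr0 GRing.mulr1.
by rewrite expgSr -mulgA step mulgA IH -mulgA -expgSr GRing.exprS GRing.mulrA.
Qed.

Lemma BS_form1 : BS_form 1.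
Proof. by exists 0%N, 0%N, 0%R; rewrite invg1 !mulg1. Qed.

Lemma BS_formt x : BS_form x -> BS_form (t * x) /\ BS_form (t^-1 * x).
Proof.
move=> [i [j [m ->]]]; split; last first.
  by exists i.+1, j, m; rewrite !mulgA expgSr invgM.
case: i => [|i].
  exists 0%N, j.+1, (m * s)%R; rewrite invg1 !mul1g mulgA.
  by have := BS_pow_conj 1 m; rewrite expg1 GRing.expr1 => ->; rewrite -mulgA -expgS.
by exists i, j, m; rewrite !mulgA expgSr invgM mulgA mulgV mul1g.
Qed.

Lemma BS_forma x : BS_form x -> BS_form (a * x) /\ BS_form (a^-1 * x).
Proof.
move=> [i [j [m ->]]].
suff H k : BS_form (expgz a k * (t ^- i * expgz a m * t ^+ j)).
  by split; [exact: (H 1%R)|exact: (H (-1)%R)].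
exists i, j, (k * s ^+ i + m)%R; rewrite expgzD !mulgA; congr (_ * _ * _).
apply: (@mulgI _ (t ^+ i)); rewrite !mulgA mulgV mul1g BS_pow_conj.
by rewrite mulgK.
Qed.

Lemma BS_form_mulr x n : BS_form x -> BS_form (x * expgz t n).
Proof.
elim/int_ind2: n x => [|n IH|n IH] x Hx; first by rewrite mulg1.
  rewrite expgzS mulgA; have [i [j [m ->]]] := IH _ Hx.
  by exists i, j.+1, m; rewrite expgSr !mulgA.
rewrite expgzP mulgA; have [i [j [m ->]]] := IH _ Hx.
case: j => [|j]; last by exists i, j, m; rewrite expgSr !mulgA mulgK.
exists i.+1, 0%N, (m * s)%R; rewrite expg0 !mulg1 expgS invgM -!mulgA; congr (_ * _).
apply: (@mulgI _ t); rewrite mulVKg.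
have := BS_pow_conj 1 m; rewrite expg1 GRing.expr1 => e.
by rewrite mulgA e mulgK.
Qed.

End NormalForm.

Section BaumslagSolitar.
Variable s : int.

Definition BS_a : BS1 s := pres_gen [set BS_relator s] false.
Definition BS_t : BS1 s := pres_gen [set BS_relator s] true.

Lemma BS1_ind (P : BS1 s -> Prop) : P 1 ->
  (forall u, P u -> P (BS_t * u) /\ P (BS_t^-1 * u)) ->
  (forall u, P u -> P (BS_a * u) /\ P (BS_a^-1 * u)) -> forall u, P u.
Proof.
by move=> P1 Pt Pa; apply: pres_ind => // -[] u Pu; [exact: Pt|exact: Pa].
Qed.

Definition letter_value (H : groupType) (a t : H) (l : bool * bool) : H :=
  let x := if l.1 then t else a in if l.2 then x else x^-1.

Lemma eval_nseq (H : groupType) (a t : H) b n :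
  eval_word *%g 1 (letter_value a t) (nseq n (false, b)) =
  (if b then a else a^-1) ^+ n.
Proof. by elim: n => //= n ->; rewrite expgS. Qed.

Lemma eval_BS_relator (H : groupType) (a t : H) :
  eval_word *%g 1 (letter_value a t) (BS_relator s) =
  t * a * t^-1 * (expgz a s)^-1.
Proof.
rewrite /BS_relator eval_word_cat; [|exact: mulgA|exact: mul1g].
rewrite eval_nseq /= mulg1 !mulgA; congr (_ * _).
case: s => n /=; first by rewrite expVgn.
by rewrite invgK.
Qed.

Lemma BS_rel : BS_t * BS_a * BS_t^-1 = expgz BS_a s.
Proof.
have piE w : (\pi_(presented [set BS_relator s]) w : BS1 s) =
    eval_word *%g 1 (letter_value BS_a BS_t) w.
  elim: w => [//|[x b] w IH].
  rewrite -cat1s -pres_piM IH /=; congr (_ * _).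
  by case: x b => [] [] //; rewrite -pres_genV.
have : (\pi_(presented [set BS_relator s]) (BS_relator s) : BS1 s) = 1.
  by apply/pres_piP; exact: pres_relator.
by rewrite piE eval_BS_relator => /divg1_eq.
Qed.

Lemma BS1_form u : BS_form BS_t BS_a u.
Proof.
elim/BS1_ind: u => [|u|u]; first exact: BS_form1.
- by move=> h; exact: (BS_formt BS_rel h).
- by move=> h; exact: (BS_forma BS_rel h).
Qed.

Section Hom.
Variables (G : groupType) (a t : G).
Hypothesis ta : t * a * t^-1 = expgz a s.

Definition BS_hom : BS1 s -> G :=
  @eval_pres _ [set BS_relator s] G *%g 1 (letter_value a t).

Lemma letter_valueV x b : letter_value a t (x, b) * letter_value a t (x, ~~ b) = 1.
Proof. by rewrite /letter_value /=; case: b; rewrite /= ?mulgV ?mulVg. Qed.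

Lemma eval_BS_relators r : [set BS_relator s] r ->
  eval_word *%g 1 (letter_value a t) r = 1.
Proof. by move=> ->; rewrite eval_BS_relator ta mulgV. Qed.

Lemma BS_homM : {morph BS_hom : x y / x * y}.
Proof.
apply: eval_presM; [exact: mulgA|exact: mul1g|exact: mulg1|..].
  exact: letter_valueV.
exact: eval_BS_relators.
Qed.

Lemma BS_hom_gen b : BS_hom (pres_gen _ b) = if b then t else a.
Proof.
rewrite /BS_hom eval_pres_pi /= ?mulg1 //.
- exact: mulgA.
- exact: mul1g.
- exact: mulg1.
- exact: letter_valueV.
- exact: eval_BS_relators.
Qed.

End Hom.
End BaumslagSolitar.

Lemma morph1 (H K : groupType) (f : H -> K) : {morph f : x y / x * y} -> f 1 = 1.
Proof. by move=> fM; apply: (@mulgI _ (f 1)); rewrite -fM !mulg1. Qed.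

Lemma morphV (H K : groupType) (f : H -> K) : {morph f : x y / x * y} ->
  forall x, f x^-1 = (f x)^-1.
Proof. by move=> fM x; apply/esym/mulg1_eq; rewrite -fM mulgV morph1. Qed.

Lemma morph_expgz (H K : groupType) (f : H -> K) : {morph f : x y / x * y} ->
  forall x m, f (expgz x m) = expgz (f x) m.
Proof.
move=> fM x; elim/int_ind2 => [|m IH|m IH]; first exact: morph1.
  by rewrite !expgzS fM IH.
by rewrite !expgzP fM IH morphV.
Qed.

(** A kernel element in normal form [t^-i a^m t^j] yields [a^m = t^(i-j)] in [G], so [indep] gives
    injectivity. *)
Lemma isomorphic_BS1 (G : groupType) (H : set G) (a t : G) (s : int) :
  s <> 0%R -> t * a * t^-1 = expgz a s ->
  (forall m n, expgz a m = expgz t n -> m = 0%R /\ n = 0%R) ->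
  (forall x, H x <-> BS_form t a x) -> isomorphic_to_some_BS1 H.
Proof.
move=> s0 ta indep HE; exists s => //.
pose f := @BS_hom s G a t.
have fM : {morph f : x y / x * y} := BS_homM ta.
have fa : f (BS_a s) = a := BS_hom_gen ta false.
have ft : f (BS_t s) = t := BS_hom_gen ta true.
have fX x (n : nat) : f (x ^+ n) = f x ^+ n := morph_expgz fM x n.
have fform i j m : f (BS_t s ^- i * expgz (BS_a s) m * BS_t s ^+ j) =
    t ^- i * expgz a m * t ^+ j.
  by rewrite !fM morphV // !fX morph_expgz // fa ft.
exists f; split=> //.
  move=> x y fxy; apply/eqP; rewrite -divg_eq1; apply/eqP.
  have : f (x * y^-1) = 1 by rewrite fM morphV // fxy mulgV.
  have [i [j [m ->]]] := BS1_form (x * y^-1).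
  rewrite fform => e.
  have [|m0 ij] := indep m (i%:Z - j%:Z)%R.
    apply: (@mulgI _ (t ^- i)); apply: (@mulIg _ (t ^+ j)); rewrite e.
    by rewrite expgzB /= mulgA mulVg mul1g mulVg.
  have -> : i = j by lia.
  by rewrite m0 /= mulg1 mulVg.
apply/seteqP; split=> [_ [u _ <-]|x /HE[i [j [m ->]]]].
  have [i [j [m ->]]] := BS1_form u.
  by rewrite fform; apply/HE; exists i, j, m.
by exists (BS_t s ^- i * expgz (BS_a s) m * BS_t s ^+ j).
Qed.

(* The affine action on [rat], with a counter of the exponent of the stable
   letter, separates the elements [a^m t^n]. *)
Definition BS_affine (s : int) (l : bool * bool) (p : rat * int) : rat * int :=
  match l with
  | (false, true) => (p.1 + 1, p.2)
  | (false, false) => (p.1 - 1, p.2)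
  | (true, true) => (s%:~R * p.1, p.2 + 1)
  | (true, false) => (p.1 / s%:~R, p.2 - 1)
  end%R.

Lemma BS1_independent (s m n : int) : s <> 0%R ->
  expgz (BS_a s) m * expgz (BS_t s) n = 1 -> m = 0%R /\ n = 0%R.
Proof.
move=> s0.
have sr0 : (s%:~R != 0 :> rat)%R by rewrite intr_eq0; exact/eqP.
pose C (f g : rat * int -> rat * int) := f \o g.
have CA : associative C by [].
have C1 : left_id id C by [].
have Cr1 : right_id id C by [].
have aV x b : C (BS_affine s (x, b)) (BS_affine s (x, ~~ b)) = id.
  apply/funext => -[p k]; case: x b => [] [] /=; congr (_, _);
    rewrite ?GRing.subrK ?GRing.addrK ?GRing.mulfK ?GRing.divfK //.
- by rewrite GRing.mulrC GRing.divfK.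
- by rewrite /= (GRing.mulrC _ p) GRing.mulfK.
have aR r : [set BS_relator s] r -> eval_word C id (BS_affine s) r = id.
  have nseqE b k p : eval_word C id (BS_affine s) (nseq k (false, b)) p =
      ((p.1 + (if b then k%:R else - k%:R))%R, p.2).
    elim: k => [|k IH] /=.
      by case: b p => [] [p q]; rewrite /= ?GRing.subr0 ?GRing.addr0.
    rewrite /C /= IH {IH}; case: b => /=; rewrite -GRing.natr1; congr (_, _); ring.
  move=> ->; apply/funext => -[p k].
  rewrite /BS_relator eval_word_cat // /C /= nseqE /=; congr (_, _); last by ring.
  rewrite (_ : (if (s < 0)%R then _ else _) = - s%:~R)%R; first by field.
  case: (s) => q /=; first by [].
  by rewrite NegzE mulrNz GRing.opprK.
pose F := @eval_pres _ [set BS_relator s] _ C id (BS_affine s).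
have FM u v : F (u * v) = C (F u) (F v) by exact: eval_presM.
have F1 : F 1 = id by rewrite /F eval_pres_pi.
have Fg x : F (pres_gen _ x) = BS_affine s (x, true) by rewrite /F eval_pres_pi.
have FV x : F (pres_gen _ x)^-1 = BS_affine s (x, false).
  by rewrite pres_genV /F eval_pres_pi.
have Fa k p : F (expgz (BS_a s) k) p = ((p.1 + k%:~R)%R, p.2).
  elim/int_ind2: k p => [|k IH|k IH] p; first by rewrite F1 GRing.addr0; case: p.
    by rewrite expgzS FM /C /= Fg IH /= intrD; congr (_, _); ring.
  by rewrite expgzP FM /C /= FV IH /= intrB; congr (_, _); ring.
have Ft k q : F (expgz (BS_t s) k) (0%R, q) = (0%R, (q + k)%R).
  elim/int_ind2: k q => [|k IH|k IH] q; first by rewrite F1 GRing.addr0.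
    by rewrite expgzS FM /C /= Fg /= GRing.mulr0 IH; congr (_, _); ring.
  by rewrite expgzP FM /C /= FV /= GRing.mul0r IH; congr (_, _); ring.
(* At the origin [t^n] changes only the counter, and [a^m] only the rational coordinate. *)
move=> e; have : F (expgz (BS_a s) m * expgz (BS_t s) n) (0%R, 0%R) = (0%R, 0%R).
  by rewrite e F1.
rewrite FM /C /= Ft Fa /= !GRing.add0r => -[/eqP + ->].
by rewrite intr_eq0 => /eqP ->.
Qed.

(** * Cylinders and commensurators *)

Section Commensurator.
Variable G : groupType.
Hypotheses (htf : torsion_free G) (hct : commutative_transitive G).
Implicit Types (b c g h x y z : G) (H : set G) (m n : int).

Definition commensurator c : set G :=
  [set g | exists m n, [/\ m <> 0%R, n <> 0%R &
    g * expgz c m * g^-1 = expgz c n]].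

Lemma mulz_neq0 m n : m <> 0%R -> n <> 0%R -> (m * n)%R <> 0%R.
Proof. by lia. Qed.

Lemma conj_expgz_mul g c m n : g * expgz c m * g^-1 = expgz c n ->
  forall k : int, g * expgz c (m * k)%R * g^-1 = expgz c (n * k)%R.
Proof. by move=> e k; rewrite expgzM expgz_conj e -expgzM. Qed.

Lemma conjV_eq g x y : g * x * g^-1 = y -> g^-1 * y * g^-1^-1 = x.
Proof. by move=> <-; rewrite invgK !mulgA mulVg mul1g mulgVK. Qed.

Lemma subgroup_commensurator c : is_subgroup (commensurator c).
Proof.
split; first by exists 1%R, 1%R; rewrite mul1g invg1 mulg1.
move=> g h [m [n [m0 n0 /conj_expgz_mul e]]].
move=> [m' [n' [m0' n0' /conj_expgz_mul e']]].
(* The element [h^-1] sends [c^(n' m)] to [c^(m' m)], which [g] sends to [c^(n m')]. *)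
exists (n' * m)%R, (n * m')%R; split; do ?exact: mulz_neq0.
rewrite -(e m') invgM invgK.
have := conjV_eq (e' m); rewrite invgK => h1.
rewrite -!mulgA (mulgA h^-1) (mulgA (h^-1 * _)) h1.
by rewrite GRing.mulrC.
Qed.

Lemma commensurator_commute c g : commute g c -> commensurator c g.
Proof. by move=> /commute_conj e; exists 1%R, 1%R. Qed.

(** The conjugate of [b] commutes with the conjugate of [c^m], which is [c^n], and a non-zero power
    of [c] has the same centralizer as [c]. *)
Lemma commensurator_normal c g b : c <> 1 -> commensurator c g ->
  commute b c -> commute (g * b * g^-1) c.
Proof.
move=> c1 [m [n [m0 n0 e]]] bc; apply: (@commute_root _ htf hct _ _ n) => //.
rewrite -e; apply/commute_conj.
have /commute_conj h := commute_expgz m bc.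
by rewrite !invgM !invgK !mulgA !mulgVK -(mulgA g b) -(mulgA g (b * _)) h.
Qed.

(* An element of [H] normalizes the cyclic group [H `&` centralizer c], so it
   centralizes it, and centralizers of nontrivial commuting elements agree. *)
Lemma commensurator_cyclic_cent c H z : c <> 1 -> is_subgroup H ->
  H `<=` commensurator c -> is_cyclic (H `&` centralizer c) ->
  z <> 1 -> H z -> commute z c -> H `<=` centralizer c.
Proof.
move=> c1 sH HW [b bE] z1 Hz zc g Hg.
have [Hb cb] : (H `&` centralizer c) b by rewrite bE; exists 1%R.
have b1 : b <> 1.
  move=> b1; have : (H `&` centralizer c) z by split; last exact: commute_sym.
  by rewrite bE => -[k _]; rewrite b1 expgz_of1 => /esym.
have conj x : H x -> exists m, x * b * x^-1 = expgz b m.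
  move=> Hx; have : (H `&` centralizer c) (x * b * x^-1).
    split; first by apply sH => //; exact: subM.
    by apply/commute_sym/commensurator_normal; [|exact: HW|exact: commute_sym].
  by rewrite bE => -[m _ <-]; exists m.
apply/commute_sym; apply: (@commute_trans _ hct _ b) => //.
  apply: (normalize_cyclic_commute htf hct) => //; first exact: conj.
  by have := conj _ (subV sH Hg); rewrite invgK.
Qed.

End Commensurator.

Section Cylinders.
Variables (G : groupType) (T : Ggraph G).
Hypotheses (htf : torsion_free G) (hct : commutative_transitive G).
Hypothesis ET : E_tree T.
Implicit Types (b c g h z : G) (H : set G) (m n : int) (u v x y : T).

Let tT : is_tree T := ET.1.

Lemma estab_edge u v : adj u v -> estab [set u; v] = vstab u `&` vstab v.
Proof.
move=> uv; have [_ _ _ ni] := tT.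
have nuv : u <> v by move=> e; move: uv; rewrite e adj_irr.
apply/seteqP; split=> [g|g [gu gv]].
  rewrite /estab /= -![_ @` _]/(act_edge _ _) act_edge2 => e.
  have : [set u; v] (act g u) by rewrite -e; left.
  have : [set u; v] (act g v) by rewrite -e; right.
  move=> [gv|gv] [gu|gu] //.
  - by case: nuv; apply: (can_inj (actK g)); rewrite gu gv.
  - by case: (ni g u v uv).
  - by case: nuv; apply: (can_inj (actK g)); rewrite gu gv.
by rewrite /estab /= -[_ @` _]/(act_edge _ _) act_edge2 gu gv.
Qed.

Lemma vstab_adj_cyclic u v : adj u v -> infinite_cyclic (vstab u `&` vstab v).
Proof. by move=> uv; rewrite -estab_edge //; apply: ET.2; exists u, v. Qed.

(** Fixed sets are convex, so what fixes [x] and [y] fixes the first edge between them. This is how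
    cyclic edge groups control stabilizers of pairs of vertices. *)
Lemma fix_step x y : x <> y -> exists2 z, adj x z &
  vstab x `&` vstab y `<=` vstab x `&` vstab z.
Proof.
move=> xy; have [z [xz b _]] := btw_step tT xy; exists z => // g [gx gy].
by split=> //; exact: (convex_fix tT) b.
Qed.

Lemma vstab2_cyclic x y H : is_subgroup H -> x <> y ->
  H `<=` vstab x `&` vstab y -> is_cyclic H.
Proof.
move=> sH xy Hxy; have [z xz sub] := fix_step xy.
apply: (cyclic_sub sH (vstab_adj_cyclic xz).1).
exact: subset_trans sub.
Qed.

Definition edge_element c : Prop :=
  c <> 1 /\ exists u v, [/\ adj u v, act c u = u & act c v = v].

Definition cyl_of c : set (set T) :=
  [set e | is_edge e /\ exists2 n, n <> 0%R & estab e (expgz c n)].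

(** For an edge element [c] these are the vertices of [cyl_of c]. The definition is also applied to
    trees in which [c] need not fix an edge. *)
Definition cyl_vertex c x : Prop :=
  exists2 n, n <> 0%R & act (expgz c n) x = x.

Lemma expgz_neq1 c n : c <> 1 -> n <> 0%R -> expgz c n <> 1.
Proof. by move=> c1 n0 /(expgz_eq1 htf c1). Qed.

Lemma cylinder_classE c (e : set T) : c <> 1 -> is_edge e -> estab e c ->
  [set e' | is_edge e' /\ commensurable (estab e) (estab e')] = cyl_of c.
Proof.
move=> c1 ee ce; have /(infinite_cyclicP htf)[x x1 ex] := ET.2 _ ee.
apply/seteqP; split=> e' [ee'].
  move/(commensurableP (ET.2 _ ee) (ET.2 _ ee')) => [z [z1 ez ez']].
  split=> //; move: ce ez; rewrite ex => -[k _ kc] [j _ jz]; exists j.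
    by move=> j0; apply: z1; rewrite -jz j0.
  rewrite -kc -expgzM GRing.mulrC expgzM jz.
  exact: subXz (subgroup_cyclic (ET.2 _ ee').1) ez'.
move=> [n n0 cn]; split=> //.
apply/(commensurableP (ET.2 _ ee) (ET.2 _ ee')); exists (expgz c n).
split=> //; first exact: expgz_neq1.
exact: subXz (subgroup_cyclic (ET.2 _ ee).1) ce.
Qed.

Lemma cylinderP Y : @is_cylinder _ T Y <-> exists2 c, edge_element c & Y = cyl_of c.
Proof.
split=> [[e ee ->]|[c [c1 [u [v [uv cu cv]]]] ->]].
  have /(infinite_cyclicP htf)[c c1 ec] := ET.2 _ ee.
  have ce : estab e c by rewrite ec; exists 1%R.
  exists c; last exact: cylinder_classE.
  split=> //; have [u [v [uv eE]]] := ee; exists u, v.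
  by move: ce; rewrite eE estab_edge // => -[].
have ee : is_edge [set u; v] by exists u, v.
by exists [set u; v] => //; rewrite (@cylinder_classE c) // estab_edge.
Qed.

Lemma cyl_of_cylinder c : edge_element c -> @is_cylinder _ T (cyl_of c).
Proof. by move=> ec; apply/cylinderP; exists c. Qed.

Lemma cyl_of_eq c d m n : m <> 0%R -> n <> 0%R -> expgz c m = expgz d n ->
  cyl_of c = cyl_of d.
Proof.
have sub a b i j : i <> 0%R -> j <> 0%R -> expgz a i = expgz b j ->
    cyl_of a `<=` cyl_of b.
  move=> i0 j0 e ed [ee [k k0 ak]]; split=> //; exists (j * k)%R.
    exact: mulz_neq0.
  rewrite expgzM -e -expgzM GRing.mulrC expgzM.
  exact: subXz (subgroup_cyclic (ET.2 _ ee).1) ak.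
by move=> m0 n0 e; apply/seteqP; split; [exact: sub e|exact: sub (esym e)].
Qed.

Lemma convex_cyl_vertex c : convex (cyl_vertex c).
Proof.
move=> x y k [m m0 cx] [n n0 cy] xky; exists (m * n)%R; first exact: mulz_neq0.
apply: (convex_fix tT) xky.
  by rewrite expgzM; exact: (subXz n (subgroup_vstab x) cx).
by rewrite GRing.mulrC expgzM; exact: (subXz m (subgroup_vstab y) cy).
Qed.

Lemma in_cylinderP c x : edge_element c ->
  in_cylinder x (cyl_of c) <-> cyl_vertex c x.
Proof.
move=> [c1 [u [v [uv cu cv]]]]; split.
  move=> [e [[a [b [ab ->]]] [n n0]]]; rewrite estab_edge // => -[na nb] /= [->|->];
  by exists n.
move=> [n n0 nx].
(* Some end [y] of the edge fixed by [c] differs from [x], so [c^n] fixes the first edge from [x]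
   towards [y]. *)
have [y cy xy] : exists2 y, act c y = y & x <> y.
  have [xu|] := pselect (x = u); last by exists u.
  exists v => // xv; move: uv; rewrite -xu -xv adj_irr //.
have [z xz sub] := fix_step xy.
exists [set x; z]; last by left.
split; first by exists x, z.
exists n => //; rewrite estab_edge //; apply: sub; split=> //.
exact: (subXz n (subgroup_vstab y) cy).
Qed.

Lemma cyl_vertex_act c g x : commensurator c g -> cyl_vertex c x ->
  cyl_vertex c (act g x).
Proof.
move=> [m [n [m0 n0 /conj_expgz_mul e]]] [k k0 kx].
exists (n * k)%R; first exact: mulz_neq0.
rewrite -e !actM actK GRing.mulrC expgzM.
by congr act; exact: (subXz m (subgroup_vstab x) kx).
Qed.

Lemma cyl_stabP c g : edge_element c ->
  act_cyl g (cyl_of c) = cyl_of c <-> commensurator c g.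
Proof.
move=> ec; have [c1 [u [v [uv cu cv]]]] := ec.
have ee : is_edge [set u; v] by exists u, v.
split=> [gY|].
  (* The image of this edge is again in the cylinder, so its cyclic stabilizer contains both [c] and
     [g^-1 c^n g]; comparing their exponents over a generator gives the relation between powers. *)
  have : cyl_of c [set u; v] by split=> //; exists 1%R; rewrite // expgz1 estab_edge.
  move/(imageP (act_edge g)); rewrite -[_ @` _]/(act_cyl _ _) gY.
  move=> [_ [n n0]]; rewrite estab_act => /conjugate_byE.
  have : estab [set u; v] c by rewrite estab_edge.
  have /(infinite_cyclicP htf)[x x1 ->] := ET.2 _ ee.
  move=> [k _ kc] [j _ jc].
  have k0 : k <> 0%R by move=> k0; apply: c1; rewrite -kc k0.
  have j0 : j <> 0%R.
    move=> j0; apply: (expgz_neq1 c1 n0); move: jc; rewrite j0 /= => e.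
    by apply: (@mulgI _ g^-1); apply: (@mulIg _ g); rewrite -e mulg1 mulVg.
  exists j, (n * k)%R; split=> //; first exact: mulz_neq0.
  have -> : expgz c j = expgz (expgz x j) k.
    by rewrite -kc -!expgzM GRing.mulrC.
  rewrite jc -[X in _ * expgz (_ * X) _ * _]invgK -expgz_conj invgK.
  by rewrite !mulgA mulgV mul1g mulgK expgzM.
have sub h : commensurator c h -> act_cyl h (cyl_of c) `<=` cyl_of c.
  move=> [m [n [m0 n0 /conj_expgz_mul e]]] _ [ed [eed [k k0 ck]] <-].
  split; first exact: is_edge_act.
  exists (n * k)%R; first exact: mulz_neq0.
  rewrite estab_act -e; exists (expgz c (m * k)) => //.
  rewrite GRing.mulrC expgzM.
  exact: subXz (subgroup_cyclic (ET.2 _ eed).1) ck.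
move=> gW; apply/seteqP; split; first exact: sub.
rewrite -{1}(act_cyl1 (cyl_of c)) -(mulgV g) act_cylM.
by apply: image_subset; apply: sub; exact: (subV (subgroup_commensurator c)).
Qed.

Lemma cyl_vertex_infinite c x : c <> 1 -> cyl_vertex c x ->
  exists2 z, z <> 1 & act z x = x /\ commute z c.
Proof.
move=> c1 [n n0 nx]; exists (expgz c n); first exact: expgz_neq1.
split=> //; exact/commute_sym/commute_expgz/commute_refl.
Qed.

Lemma vstab_cyl_cent c x : c <> 1 -> cyl_vertex c x ->
  is_cyclic (vstab x `&` centralizer c) ->
  vstab x `&` commensurator c `<=` centralizer c.
Proof.
move=> c1 xY cyc; have [z z1 [zx zc]] := cyl_vertex_infinite c1 xY.
apply: (@commensurator_cyclic_cent _ htf hct c _ z) => //.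
- exact: subI (subgroup_vstab x) (subgroup_commensurator c).
- apply: cyclic_sub cyc _ => [|g [[]] //].
  apply: subI (subgroup_centralizer c).
  exact: subI (subgroup_vstab x) (subgroup_commensurator c).
- by split=> //; exact: commensurator_commute.
Qed.

(** A non-cyclic group fixes at most one vertex. As [A = centralizer c] is abelian, its part fixing
    [x] also fixes every translate of [x] by [A], so [A] fixes [x]; as the commensurator normalizes
    [A], it fixes [x] too. *)
Lemma noncyclic_commensurator_sub c x : c <> 1 ->
  ~ is_cyclic (vstab x `&` centralizer c) -> commensurator c `<=` vstab x.
Proof.
move=> c1 nc.
have sK : is_subgroup (vstab x `&` centralizer c).
  exact: subI (subgroup_vstab x) (subgroup_centralizer c).
have cA : centralizer c `<=` vstab x.
  move=> g cg; apply: contrapT => gx; apply: nc.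
  apply: (@vstab2_cyclic x (act g x)) => //; first exact/nesym.
  move=> h [hx ch]; split=> //.
  rewrite /vstab /= -actM (_ : h * g = g * h) ?actM ?hx //.
  by apply: (commute_trans hct c1) cg; exact: commute_sym.
move=> g gW; apply: contrapT => gx; apply: nc.
apply: (@vstab2_cyclic x (act g x)) => //; first exact/nesym.
move=> h [hx ch]; split=> //.
have := commensurator_normal htf hct c1
  (subV (subgroup_commensurator c) gW) (commute_sym ch).
rewrite invgK => /commute_sym/cA; rewrite /vstab /= !actM => e.
by rewrite -[X in _ = act g X]e actVK.
Qed.

End Cylinders.

(** * Stabilizers of cylinders *)

Section OrbitsOfEdges.
Variables (G : groupType) (T : Ggraph G).
Hypothesis tT : is_tree T.
Implicit Types (x y z u v : T) (g h : G).

Lemma finite_btw x y : finite_set [set m : T | btw x m y].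
Proof.
apply: (@finite_preimage_inj _ _ _ (dist x)) => [m m' /= b b'|].
  exact: (btw_unique tT b b').
apply: (@sub_finite_set _ _ `I_(dist x y).+1); last exact: finite_II.
by move=> _ [m /= b <-]; move: b; rewrite /btw /=; lia.
Qed.

(** The vertex version could put the two ends on different sides of the tripod. Seen from [w],
    however, the edge leads either nearer or farther, and this decides for both ends. *)
Lemma btw_edge_split x y w a b : adj a b -> btw x a y -> btw x b y ->
  (btw x a w /\ btw x b w) \/ (btw w a y /\ btw w b y).
Proof.
wlog ab : a b / dist x b = (dist x a).+1.
  move=> W adab xa xb; have [e|e] := dist_adj tT x adab; last exact: W.
  by have := W b a e; rewrite adj_sym => /(_ adab xb xa) [[]|[]]; [left|right].
move=> adab xay xby; have /(dist1P tT) d1 := adab.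
have xab : btw x a b by rewrite /btw ab d1 addn1.
have nab : a <> b by move=> e; move: d1; rewrite e (distxx tT).
have [e|e] := dist_adj tT w adab; last first.
  right; have wab : btw w a b by rewrite /btw e d1 addn1.
  have wby : btw w b y.
    apply: (btw_glue tT nab wab).
    by have [_] := btw_trans tT xby xab.
  by split=> //; have [] := btw_trans tT wby wab.
left; have abw : btw a b w.
  by move: e; rewrite /btw d1 (distC tT w a) (distC tT w b) => ->; rewrite add1n.
have xbw : btw x b w := btw_glue tT nab xab abw.
by split=> //; have [] := btw_trans tT xbw xab.
Qed.

(* The translates of the segments from [x] to [s x], for [s] in a finite
   generating set, form a connected subgraph with finitely many orbits. *)
Lemma fin_generated_edge_orbits x : fin_generated G ->
  exists2 K : set (T * T), finite_set K &
    forall g y z, adj y z -> btw x y (act g x) -> btw x z (act g x) ->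
    exists2 e, K e & exists h, act h e.1 = y /\ act h e.2 = z.
Proof.
move=> [S fS genS].
pose seg g := [set m : T | btw x m (act g x)].
exists (\bigcup_(s in S) (seg s `*` seg s)).
  apply: bigcup_finite => // s _.
  by apply: finite_setX; exact: finite_btw.
pose H := [set g | forall y z, adj y z -> btw x y (act g x) ->
  btw x z (act g x) -> exists2 e, (\bigcup_(s in S) (seg s `*` seg s)) e &
    exists h, act h e.1 = y /\ act h e.2 = z].
suff HT : H = setT by move=> g; have : H g by rewrite HT.
apply: genS; last first.
  move=> s Ss y z yz xy xz; exists (y, z); first by exists s.
  by exists 1; rewrite !act1.
split=> [y z yz|g h Hg Hh y z yz xy xz].
  rewrite act1 => /(btwxx tT) yx /(btwxx tT) zx.
  by move: yz; rewrite yx zx adj_irr.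
have [[xy' xz']|[yg zg]] := btw_edge_split (act g x) yz xy xz; first exact: Hg.
(* The element [h * g^-1] carries the segment from [act g x] to [act (g * h^-1) x] to the one from
   [act h x] to [x]. *)
have tr m : btw (act g x) m (act (g * h^-1) x) ->
    btw x (act (h * g^-1) m) (act h x).
  move=> b; apply/(btwC tT); have := btw_act tT (h * g^-1) b.
  rewrite -!actM !mulgA mulgVK.
  by rewrite mulgV act1.
have [|e Ke [k [ey ez]]] := Hh _ _ _ (tr _ yg) (tr _ zg); first by rewrite act_adj.
exists e => //; exists (g * h^-1 * k); rewrite !actM ey ez !actM !actK.
by rewrite !actVK.
Qed.

End OrbitsOfEdges.

(** * Commensurators that are not elliptic *)

Section Dichotomy.
Variables (G : groupType) (T : Ggraph G).
Hypotheses (htf : torsion_free G) (hct : commutative_transitive G).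
Hypothesis ET : E_tree T.
Variable c : G.
Hypothesis ec : edge_element T c.
Implicit Types (a b g h z : G) (m n k : int) (u v x y p : T).

Let tT : is_tree T := ET.1.
Let c1 : c <> 1 := ec.1.

Lemma cent_commute g h : commute g c -> commute h c -> commute g h.
Proof. by move=> gc hc; apply: (commute_trans hct c1) gc (commute_sym hc). Qed.

(** Elliptic elements of [A = centralizer c] have zero shift along the axis of [h], so they fix [p]
    and form the group [K], cyclic because it also fixes [act h p]. The commensurator normalizes
    [K], hence centralizes it and equals [A], which [K] and an element [t] of generating shift
    generate. *)
Lemma hyperbolic_cylinder h : commute h c -> (forall v, act h v <> v) ->
  isomorphic_to_some_BS1 (commensurator c).
Proof.
move=> hc nh; have [p [L [L0 hL]]] := hyperbolic_axis tT nh.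
pose F := axis_tails h p.
have F0 : F !=set0 := axis_tails0 h p.
have FN : forall A, F A -> A !=set0 := @axis_tailsN _ _ h p.
have FD : forall A B, F A -> F B -> exists2 C, F C & C `<=` A `&` B :=
  @axis_tailsD _ _ h p.
have FA : forall y z : T, adj y z -> exists k, horo F y z k := axis_tailsA tT L0 hL.
have inv g : commute g c -> forall (y z : T) k, horo F y z k ->
    horo F (act g y) (act g z) k.
  move=> gc; apply: (axis_horo_inv tT L0 hL); exact: cent_commute.
have fix_p b v : commute b c -> act b v = v -> act b p = p.
  move=> bc bv; have [k sk] := shift_ex tT F0 FD FA (inv _ bc).
  have k0 := shift_fix F0 FN FD sk bv; subst k.
  exact: (axis_shift0_fix tT L0 hL) (cent_commute bc hc) sk.
pose K := vstab p `&` centralizer c.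
have [a aE] : is_cyclic K.
  apply: (@vstab2_cyclic _ T ET p (act h p)); last 2 first.
  - exact/nesym/nh.
  - move=> g [gp gc]; split=> //; rewrite /vstab /= -actM.
    by rewrite (cent_commute (commute_sym gc) hc) actM gp.
  exact: subI (subgroup_vstab p) (subgroup_centralizer c).
have [ap ca] : K a by rewrite aE; exists 1%R.
have Kc : K c.
  have [_ [u [v [_ cu _]]]] := ec.
  by split; [exact: fix_p cu|exact: commute_refl].
have a1 : a <> 1.
  by move=> a1; move: Kc; rewrite aE => -[k _]; rewrite a1 expgz_of1 => /esym.
have Wc g : commensurator c g -> commute g c.
  move=> gW; apply: (@commute_trans _ hct _ a) => //.
  have conj (x : G) : commensurator c x -> exists m, x * a * x^-1 = expgz a m.
    move=> xW; have : K (x * a * x^-1).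
      have cx : commute (x * a * x^-1) c.
        exact: (commensurator_normal htf hct c1) xW (commute_sym ca).
      split; last exact: commute_sym.
      by apply: (fix_p _ (act x p)) => //; rewrite !actM actK ap.
    by rewrite aE => -[m _ <-]; exists m.
  apply: (normalize_cyclic_commute htf hct) => //; first exact: conj.
  by have := conj _ (subV (subgroup_commensurator c) gW); rewrite invgK.
have [|m n [g gc gm] [g' gc' gm']|d [[t tc st] dP]] :=
    @int_subgroup [set m | exists2 g, commute g c & shift F g m].
- by exists 1; [exact/commute_sym/commute1|exact: shift1].
- exists (g * g'^-1); last by apply: (shiftM FD gm); exact: shiftV.
  by apply/commute_sym/commuteM; [|apply/commuteV]; exact: commute_sym.
have stn n : shift F (expgz t n) (n * d%:Z)%R := shift_expgz F0 FD n st.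
have ta : commute t a := cent_commute tc (commute_sym ca).
have d0 : d <> 0%N.
  move=> d0; have : shift F h (- L%:Z)%R := axis_shift_self tT L0 hL.
  have [|n] := dP (- L%:Z)%R; first by exists h => //; exact: axis_shift_self.
  by rewrite d0 GRing.mulr0; lia.
apply: (@isomorphic_BS1 _ _ a t 1%R) => //.
- exact/commute_conj.
- move=> m n e.
  have n0 : n = 0%R.
    have am : act (expgz a m) p = p := subXz m (subgroup_vstab p) ap.
    rewrite e in am; have := shift_fix F0 FN FD (stn n) am; lia.
  by split=> //; apply: (expgz_eq1 htf a1); rewrite e n0.
move=> x; split=> [/Wc xc|[i [j [m ->]]]].
  have [k sk] := shift_ex tT F0 FD FA (inv _ xc).
  have [|n kn] := dP k; first by exists x.
  pose b := x * (expgz t n)^-1.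
  have bc : commute b c.
    apply/commute_sym/commuteM; first exact: commute_sym.
    by apply/commuteV/commute_expgz; exact: commute_sym.
  have sb : shift F b 0%R.
    by have := shiftM FD sk (shiftV (stn n)); rewrite kn GRing.subrr.
  have : K b.
    split; last exact: commute_sym.
    exact: (axis_shift0_fix tT L0 hL) (cent_commute bc hc) sb.
  rewrite aE => -[m _ am].
  have -> : x = expgz a m * expgz t n by rewrite am /b mulgVK.
  apply: (BS_form_mulr (s := 1%R)); first exact/commute_conj.
  by exists 0%N, 0%N, m; rewrite expg0 invg1 mul1g mulg1.
apply/commensurator_commute/commute_sym/commuteM; last first.
  exact/commuteX/commute_sym.
by apply: commuteM; [exact/commuteV/commuteX/commute_sym|exact: commute_expgz].
Qed.

Lemma edge_common_power u v g h : adj u v -> g <> 1 -> h <> 1 ->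
  (vstab u `&` vstab v) g -> (vstab u `&` vstab v) h ->
  exists m n, [/\ m <> 0%R, n <> 0%R & expgz g m = expgz h n].
Proof.
move=> uv g1 h1; have /(infinite_cyclicP htf)[x x1 ->] := vstab_adj_cyclic ET uv.
move=> [i _ ig] [j _ jh]; exists j, i; split.
- by move=> j0; apply: h1; rewrite -jh j0.
- by move=> i0; apply: g1; rewrite -ig i0.
- by rewrite -ig -jh -!expgzM GRing.mulrC.
Qed.

(** * The case of a centralizer with only elliptic elements *)

Section LocallyElliptic.
Hypothesis nellW : ~ elliptic T (commensurator c).
Hypothesis ellA : forall a, commute a c -> exists v, act a v = v.

Let W := commensurator c.
Let sW : is_subgroup W := subgroup_commensurator c.

Lemma vstab_cent_cyclic x : is_cyclic (vstab x `&` centralizer c).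
Proof.
apply: contrapT => nc; apply: nellW; exists x.
exact: (noncyclic_commensurator_sub htf hct ET c1).
Qed.

(** If [A = centralizer c] fixed [x], it would be cyclic; then [W], which normalizes it, would lie
    in [A] and fix [x] as well. *)
Lemma cent_moves x : exists2 a, commute a c & act a x <> x.
Proof.
apply: contrapT => nA.
have Ax : centralizer c `<=` vstab x.
  by move=> a ca; apply: contrapT => ax; apply: nA; exists a.
apply: nellW; exists x; apply: subset_trans (Ax).
apply: (@commensurator_cyclic_cent _ htf hct c W c) => //.
  have -> : W `&` centralizer c = vstab x `&` centralizer c.
    apply/seteqP; split=> g [gW cg]; split=> //; first exact: Ax.
    by apply: commensurator_commute; exact: commute_sym.
  exact: vstab_cent_cyclic.
by apply: commensurator_commute; exact: commute_refl.
Qed.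

(** Any two of these subtrees contain a third, yet no vertex lies in all of them: they shrink
    towards an end. *)
Definition end_sets : set (set T) :=
  [set X | exists2 a, commute a c & X = @fix_set _ T a].

Lemma end_sets0 : end_sets !=set0.
Proof. by exists (@fix_set _ T c), c => //; exact: commute_refl. Qed.

Lemma end_setsN X : end_sets X -> X !=set0.
Proof. by move=> [a ac ->]; have [v av] := ellA ac; exists v. Qed.

(** The elements [a] and [b] fix a common vertex [x], so both are powers of a generator [d] of the
    cyclic group of elements of [A] fixing [x], and the fixed set of [d] lies in both of theirs. *)
Lemma end_setsD X Y : end_sets X -> end_sets Y ->
  exists2 Z, end_sets Z & Z `<=` X `&` Y.
Proof.
move=> [a ac ->] [b bc ->].
have [u au] := ellA ac; have [v bv] := ellA bc.
have [x ax bx] := commuting_fix tT (cent_commute ac bc) au bv.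
have [d dE] := vstab_cent_cyclic x.
have [dx cd] : (vstab x `&` centralizer c) d by rewrite dE; exists 1%R.
exists (@fix_set _ T d); first by exists d => //; exact: commute_sym.
have fd e : act e x = x -> commute e c -> @fix_set _ T d `<=` @fix_set _ T e.
  move=> ex ec' y dy; have : (vstab x `&` centralizer c) e.
    by split=> //; exact: commute_sym.
  by rewrite dE => -[k _ <-]; exact: (subXz k (subgroup_vstab y) dy).
by move=> y dy; split; apply: fd dy.
Qed.

Lemma end_sets_convex X : end_sets X -> convex X.
Proof. by move=> [a _ ->]; exact: convex_fix. Qed.

Lemma end_sets_avoid X x : end_sets X -> exists Z, [/\ end_sets Z, Z `<=` X & ~ Z x].
Proof.
move=> eX; have [a ac ax] := cent_moves x.
have [|Z eZ ZX] := end_setsD eX (_ : end_sets (@fix_set _ T a)); first by exists a.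
by exists Z; split=> // [y /ZX[]|/ZX[]].
Qed.

(** A fixed subtree avoiding both [y] and [z] lies entirely on one side of the edge, since it is
    convex; the side decides between the values 1 and -1. *)
Lemma end_setsA (y z : T) : adj y z -> exists k, horo end_sets y z k.
Proof.
move=> yz; have [X0 eX0] := end_sets0.
have [X1 [eX1 _ X1y]] := end_sets_avoid y eX0.
have [X [eX XX1 Xz]] := end_sets_avoid z eX1.
have {X1y} Xy : ~ X y by move/XX1.
have /(dist1P tT) d1 := yz.
have key (a b u u' : T) : adj a b -> ~ X a -> X u -> X u' ->
    dist u a = (dist u b).+1 -> dist u' b = (dist u' a).+1 -> False.
  move=> ab Xa Xu Xu' e e'; have /(dist1P tT) dab := ab.
  have nab : b <> a by move=> h; move: dab; rewrite h (distxx tT).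
  apply: Xa; apply: (end_sets_convex eX Xu Xu').
  have dba := distC tT b a.
  apply: (btw_glue tT nab); first by rewrite /btw e dba dab addn1.
  by rewrite /btw dba dab (distC tT a) (distC tT b) e' add1n.
have zy : adj z y by rewrite adj_sym.
have [u0 Xu0] := end_setsN eX.
have [e|e] := dist_adj tT u0 yz; [exists 1%R|exists (-1)%R]; exists X => // u Xu;
  rewrite !(distC tT _ u).
- have [h|h] := dist_adj tT u yz; first by lia.
  by case: (key _ _ _ _ yz Xy Xu0 Xu e h).
- have [h|h] := dist_adj tT u yz; last by lia.
  by case: (key _ _ _ _ zy Xz Xu0 Xu e h).
Qed.

Lemma end_sets_act g X : W g -> end_sets X ->
  exists2 Z, end_sets Z & forall u, Z u -> X (act g^-1 u).
Proof.
move=> gW [a ac ->]; exists (@fix_set _ T (g * a * g^-1)).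
  by exists (g * a * g^-1) => //; exact: (commensurator_normal htf hct c1).
by move=> u; rewrite /fix_set /= -{2}(actVK g u) !actM => /(can_inj (actK g)).
Qed.

Lemma end_horo_inv g (y z : T) k : W g -> horo end_sets y z k ->
  horo end_sets (act g y) (act g z) k.
Proof.
move=> gW [X eX HX]; have [Z eZ ZX] := end_sets_act gW eX.
exists Z => // u /ZX/HX; rewrite -(dist_act tT g) actVK -(dist_act tT g z) actVK.
by [].
Qed.

Let shift_exW g : W g -> exists k, shift end_sets g k.
Proof.
move=> gW; apply: (shift_ex tT end_sets0 end_setsD end_setsA) => y z k.
exact: end_horo_inv.
Qed.

Lemma cent_shift0 a : commute a c -> shift end_sets a 0%R.
Proof.
move=> ac; have [v av] := ellA ac.
have [k sk] := shift_exW (commensurator_commute ac).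
by rewrite -(shift_fix end_sets0 end_setsN end_setsD sk av).
Qed.

(** With zero shift, [g] fixes a vertex [m] between [u] and [act g u]. It belongs to the cylinder,
    and the elements of [W] fixing it centralize [c]. *)
Lemma shift0_cent g : W g -> shift end_sets g 0%R -> commute g c.
Proof.
move=> gW sg; have [_ [u [v [_ cu _]]]] := ec.
have uY : cyl_vertex c u by exists 1%R.
have [|m [um dm _]] := @shift_axis _ _ tT _ end_setsN end_setsD g 0%N u _ sg.
  by move=> y z k; exact: end_horo_inv.
have gm : act g m = m by apply/esym/(dist_eq0 tT).
have mY : cyl_vertex c m.
  apply: (convex_cyl_vertex ET) um => //.
  exact: (cyl_vertex_act gW).
apply/commute_sym.
by apply (vstab_cyl_cent htf hct c1 mY (vstab_cent_cyclic m)).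
Qed.

(** Each new set avoids the previous gate [p], so its own gate lies strictly beyond [p] as seen from
    [x]. *)
Lemma end_sets_far x (n : nat) : exists X p, [/\ end_sets X, X p,
  forall u, X u -> btw x p u & (n <= dist x p)%N].
Proof.
elim: n => [|n [X [p [eX Xp Xg np]]]].
  have [X eX] := end_sets0.
  have [p Xp gp] := gate tT x (end_sets_convex eX) (end_setsN eX).
  by exists X, p.
have [Z [eZ ZX Zp]] := end_sets_avoid p eX.
have [q Zq gq] := gate tT x (end_sets_convex eZ) (end_setsN eZ).
exists Z, q; split=> //.
have pq : dist p q <> 0%N by move=> /(dist_eq0 tT) pq; apply: Zp; rewrite pq.
have := Xg _ (ZX _ Zq); rewrite /btw; lia.
Qed.

(* If every element of [W] had zero shift, a long segment towards the end
   fixed by [W] would consist of edges in distinct orbits, as an element of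
   [G] sending one of them to another belongs to [W]. *)
Lemma shift_nonzero : fin_generated G ->
  exists2 g, W g & ~ shift end_sets g 0%R.
Proof.
move=> hfg; apply: contrapT => allz.
have {}allz g : W g -> shift end_sets g 0%R.
  by move=> gW; apply: contrapT => ng; apply: allz; exists g.
have [_ [x [v [_ cx _]]]] := ec.
have xY : cyl_vertex c x by exists 1%R.
have [K /finite_seqP[s ->] HK] := fin_generated_edge_orbits tT x hfg.
(* One edge more than there are representatives, so that two edges share one. *)
pose N := (size s).+1.
have [X [p [eX Xp Xg Np]]] := end_sets_far x N.
have [a ac XE] := eX; have [w aw] := ellA ac.
(* The segment from [x] to [p] is part of the one from [x] to [act a x]: it consists of vertices of
   the cylinder, and its edges are covered by the finite set of representatives. *)
have [m xm am] := elliptic_mid tT x aw.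
have pm : btw x p m by apply: Xg; rewrite XE.
have inseg q : btw x q p -> btw x q (act a x).
  move=> xq; have [h1 _] := btw_trans tT pm xq.
  by have [] := btw_trans tT xm h1.
have inY q : btw x q p -> cyl_vertex c q.
  move/inseg; apply: (convex_cyl_vertex ET) => //.
  by apply: (cyl_vertex_act (commensurator_commute ac)).
have edges (i : 'I_N) : exists e : T * T, [/\ e \in s &
    exists h (y z : T), [/\ adj y z, btw x y p, btw x z p, dist x y = i &
      act h e.1 = y /\ act h e.2 = z]].
  have iN : (i < dist x p)%N by apply: leq_trans Np.
  have [y xy dy] := btw_at tT (ltnW iN).
  have yp : y <> p by move=> yp; move: iN; rewrite -dy yp ltnn.
  have [z [yz yzp dz]] := btw_step tT yp.
  have xz : btw x z p.
    by apply/(btwC tT); have [] := btw_trans tT (btwC tT xy) (btwC tT yzp).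
  have [e Ke [h eh]] := HK _ _ _ yz (inseg _ xy) (inseg _ xz).
  by exists e; split=> //; exists h, y, z.
have [f Hf] := choice edges.
have finj : injective f.
  move=> i j fij.
  have [_ [h [y [z [yz xy xz dy [ey ez]]]]]] := Hf i.
  have [_ [h' [y' [z' [yz' xy' xz' dy' [ey' ez']]]]]] := Hf j.
  pose g := h' * h^-1.
  have gy : act g y = y' by rewrite -ey -ey' fij actM actK.
  have gz : act g z = z' by rewrite -ez -ez' fij actM actK.
  clearbody g.
  have [k k0 ky] : cyl_vertex c y by exact: inY.
  have [l l0 lz] : cyl_vertex c z by exact: inY.
  have [k' k0' ky'] : cyl_vertex c y' by exact: inY.
  have [l' l0' lz'] : cyl_vertex c z' by exact: inY.
  have both i1 i2 u1 u2 : act (expgz c i1) u1 = u1 -> act (expgz c i2) u2 = u2 ->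
      (vstab u1 `&` vstab u2) (expgz c (i1 * i2)%R).
    move=> e1 e2; split; first by rewrite expgzM; exact: (subXz _ (subgroup_vstab u1)).
    by rewrite GRing.mulrC expgzM; exact: (subXz _ (subgroup_vstab u2)).
  have [gy1 gz1] := both _ _ _ _ ky lz.
  have kl0 := mulz_neq0 k0 l0; have kl0' := mulz_neq0 k0' l0'.
  (* The stabilizer of the edge from [y'] to [z'] is infinite cyclic and contains a power of [c] as
     well as a conjugate by [g] of another. *)
  have gW : W g.
    have [||||i1 [i2 [i10 i20 e12]]] := @edge_common_power y' z'
        (g * expgz c (k * l)%R * g^-1) (expgz c (k' * l')%R) yz'.
    - move=> e1; apply: (expgz_neq1 htf c1 kl0).
      by apply: (@mulgI _ g); apply: (@mulIg _ g^-1); rewrite e1 mulg1 mulgV.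
    - exact: expgz_neq1.
    - split; rewrite /vstab /= -?gy -?gz !actM actK; first by rewrite gy1.
      by rewrite gz1.
    - exact: both.
    exists ((k * l) * i1)%R, ((k' * l') * i2)%R; split; do ?exact: mulz_neq0.
    by rewrite (expgzM c (k * l)%R) expgz_conj e12 -expgzM.
  (* On this segment the cocycle based at [x] is the distance to [x], so zero shift forces
     [i = j]. *)
  have hor q : btw x q p -> horo end_sets x q (dist x q)%:Z.
    move=> xq; exists X => // u Xu.
    by have [] := btw_trans tT (Xg _ Xu) xq; rewrite /btw => <-; lia.
  have := allz _ gW y; rewrite gy => hyy.
  have := horo_unique end_setsN end_setsD
    (horo_add end_setsD (hor _ xy') hyy) (hor _ xy).
  by rewrite dy dy' => e; apply/val_inj => /=; lia.
have : uniq (map f (enum 'I_N)) by rewrite map_inj_uniq // enum_uniq.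
move/uniq_leq_size => /(_ s) h.
have : (N <= size s)%N.
  rewrite -[N]card_ord cardE -(size_map f); apply: h => _ /mapP[i _ ->].
  by have [] := Hf i.
by rewrite ltnn.
Qed.

(** Let [p] be a vertex that [t^-1] translates towards the end, and [a] a generator of the part of
    [A] fixing [p]. Every element of [A] fixes some [act (t ^- N) p], so its conjugate by [t^N] is a
    power of [a]; the remaining elements of [W] differ from these by powers of [t]. *)
Lemma locally_elliptic_cylinder : fin_generated G -> isomorphic_to_some_BS1 W.
Proof.
move=> hfg; have [g0 g0W ng0] := shift_nonzero hfg.
have sM g h k l := @shiftM _ _ _ end_setsD g h k l.
have [|m n [g gW gm] [g' gW' gm']|d [[t tW st] dP]] :=
    @int_subgroup [set m | exists2 g, W g & shift end_sets g m].
- by exists 1; [exact: sub1|exact: (shift1 end_sets0)].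
- exists (g * g'^-1); last by apply: sM gm _; exact: shiftV.
  by apply sW.
have stn n : shift end_sets (expgz t n) (n * d%:Z)%R :=
  shift_expgz end_sets0 end_setsD n st.
have d0 : d <> 0%N.
  move=> d0; have [k sk] := shift_exW g0W; apply: ng0.
  have [|n kn] := dP k; first by exists g0.
  by move: sk; rewrite kn d0 GRing.mulr0.
have tVW : W t^-1 := subV sW tW.
have [_ [x [v [_ cx _]]]] := ec.
(* The shift of [t] is positive, so it is [t^-1] that moves towards the end. *)
have [|p [xp dp [X eX HX]]] :=
    @shift_axis _ _ tT _ end_setsN end_setsD t^-1 d x _ (shiftV st).
  by move=> y z k; exact: end_horo_inv.
have pY : cyl_vertex c p.
  have xY : cyl_vertex c x by exists 1%R.
  apply: (convex_cyl_vertex ET) xp => //; exact: cyl_vertex_act.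
have [a aE] := vstab_cent_cyclic p.
have [ap ca] : (vstab p `&` centralizer c) a by rewrite aE; exists 1%R.
have in_a b : commute b c -> act b p = p -> exists m, b = expgz a m.
  move=> bc bp; have : (vstab p `&` centralizer c) b by split=> //; exact: commute_sym.
  by rewrite aE => -[m _ <-]; exists m.
have a1 : a <> 1.
  have [z z1 [zp zc]] := cyl_vertex_infinite htf c1 pY.
  by move=> a1; have [m] := in_a _ zc zp; rewrite a1 expgz_of1.
have ac : commute a c := commute_sym ca.
(* The element [a] fixes [p] and a vertex [u] near the end, hence also [act t^-1 p], which lies
   between them. *)
have [s ta] : exists s, t * a * t^-1 = expgz a s.
  apply: in_a; first exact: (commensurator_normal htf hct c1).
  have [|Z eZ ZX] := end_setsD eX (_ : end_sets (@fix_set _ T a)); first by exists a.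
  have [u Zu] := end_setsN eZ; have [Xu au] := ZX _ Zu.
  have : act a (act t^-1 p) = act t^-1 p by exact: (convex_fix tT) (HX _ Xu).
  by rewrite !actM => ->; rewrite actVK.
have s0 : s <> 0%R.
  move=> s0; apply: a1; apply: (@mulgI _ t); apply: (@mulIg _ t^-1).
  by rewrite ta s0 mulg1 mulgV.
have ray (n : nat) : dist p (act (t^-1 ^+ n) p) = (n * d)%N /\
    exists2 Z, end_sets Z & forall u, Z u -> btw p (act (t^-1 ^+ n) p) u.
  elim: n => [|n [dn [Z eZ HZ]]].
    rewrite act1 (distxx tT); split=> //; exists X => // u _; exact: btwl.
  have tnW : W (t^-1 ^+ n) := subXz n sW tVW.
  have [Z1 eZ1 HZ1] := end_sets_act tnW eX.
  have [Z2 eZ2 HZ2] := end_setsD eZ eZ1.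
  have key u : Z2 u -> btw p (act (t^-1 ^+ n) p) (act (t^-1 ^+ n.+1) p) /\
      btw p (act (t^-1 ^+ n.+1) p) u.
    move=> /HZ2[/HZ h1 /HZ1/HX/(btw_act tT (t^-1 ^+ n))].
    rewrite actVK -actM -expgSr => h2.
    have [h3 h4] := btw_trans tT (btwC tT h1) (btwC tT h2).
    by split; exact: (btwC tT).
  split; last by exists Z2 => // u /key[].
  have [u /key[+ _]] := end_setsN eZ2; rewrite /btw dn expgSr actM (dist_act tT) dp.
  by rewrite mulSn addnC.
have cent_form b : commute b c -> BS_form t a b.
  move=> bc; have [u0 bu0] := ellA bc.
  (* The vertex [q] is at distance [N * d], at least [N], from [p]. So it is [u0], or it lies
     between [u0] and a vertex [u] near the end, both fixed by [b]. *)
  pose N := dist p u0; have [dN [Z eZ HZ]] := ray N.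
  have [|Z1 eZ1 HZ1] := end_setsD eZ (_ : end_sets (@fix_set _ T b)); first by exists b.
  have [u /HZ1[/HZ pu bu]] := end_setsN eZ1.
  set q := act _ p in dN pu.
  have bq : act b q = q.
    have [h|h] := btw_split tT u0 pu; last exact: (convex_fix tT) h.
    suff -> : q = u0 by [].
    apply: (dist_eq0 tT); move: h dN; rewrite /btw -/N; move: (dist q u0) => e.
    have : (N <= N * d)%N by rewrite leq_pmulr; lia.
    lia.
  have tN : q = act (t ^- N) p by rewrite /q expVgn.
  have [||m bm] := in_a (t ^+ N * b * t ^- N).
  - by apply: (commensurator_normal htf hct c1) bc; exact: (subXz N sW tW).
  - by rewrite !actM -tN bq tN actVK.
  exists N, N, m; rewrite -bm !mulgA mulVg mul1g mulgVK //.
apply: (@isomorphic_BS1 _ _ a t s) => // [m n e|g].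
  have sa : shift end_sets (expgz a m) 0%R.
    by apply/cent_shift0/commute_sym/commute_expgz.
  have n0 : n = 0%R.
    rewrite e in sa; have := shift_unique tT end_setsN end_setsD sa (stn n); lia.
  by split=> //; apply: (expgz_eq1 htf a1); rewrite e n0.
split=> [gW|[i [j [m ->]]]].
  have [k sk] := shift_exW gW.
  have [|n kn] := dP k; first by exists g.
  have -> : g = g * (expgz t n)^-1 * expgz t n by rewrite mulgVK.
  apply: (BS_form_mulr ta); apply: cent_form; apply: shift0_cent.
    by apply sW => //; exact: subXz.
  by have := sM _ _ _ _ sk (shiftV (stn n)); rewrite kn GRing.subrr.
apply: subM => //; last exact: (subXz j sW tW).
apply: subM => //; last exact/(subXz m sW)/commensurator_commute.
exact/(subV sW)/(subXz i sW tW).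
Qed.

End LocallyElliptic.

Lemma cylinder_dichotomy : fin_generated G ->
  elliptic T (commensurator c) \/ isomorphic_to_some_BS1 (commensurator c).
Proof.
move=> hfg; have [|nell] := pselect (elliptic T (commensurator c)); first by left.
right; have [[h [hc nh]]|nhyp] :=
    pselect (exists h, commute h c /\ forall v : T, act h v <> v).
  exact: hyperbolic_cylinder nh.
apply: locally_elliptic_cylinder => // a ac; apply: contrapT => na.
by apply: nhyp; exists a; split=> // v av; apply: na; exists v.
Qed.

End Dichotomy.

(** * The tree of cylinders *)

(** A representative of each orbit goes to a vertex fixed by its stabilizer, and equivariance
    determines the rest. The representative is chosen as a function of the orbit, as a set, so that
    it is the same along the orbit. *)
Lemma dominates_of_elliptic (G : groupType) (X T : Ggraph G) :
  (forall w : X, elliptic T (vstab w)) -> dominates X T.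
Proof.
move=> ell; have [e He] := choice ell.
pose O (w : X) := [set x : X | exists g, act g x = w].
(* The value [None] serves the empty set. *)
have [S|r Hr] := @choice (set X) (option X)
    (fun S o => S !=set0 -> exists2 x, o = Some x & S x).
  have [[x Sx]|nS] := pselect (S !=set0); last by exists None.
  by exists (Some x) => _; exists x.
have ex w : exists gx : G * X, r (O w) = Some gx.2 /\ act gx.1 gx.2 = w.
  have [|x rx [g gx]] := Hr (O w); first by exists w, 1; rewrite act1.
  by exists (g, x).
have [f Hf] := choice ex.
exists (fun w => act (f w).1 (e (f w).2)) => h w.
have OE : O (act h w) = O w.
  apply/seteqP; split=> x [g gx]; last by exists (h * g); rewrite actM gx.
  by exists (h^-1 * g); rewrite actM gx actK.
have [r1 a1] := Hf w; have [r2 a2] := Hf (act h w).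
have fE : (f (act h w)).2 = (f w).2 by move: r2; rewrite OE r1 => -[].
rewrite fE -actM; rewrite fE in a2.
have : vstab (f w).2 ((h * (f w).1)^-1 * (f (act h w)).1).
  have a3 : act (h * (f w).1) (f w).2 = act h w by rewrite actM a1.
  by rewrite /vstab /= actM a2 -a3 actK.
move=> /He e1; apply: (can_inj (actK (h * (f w).1)^-1)).
by rewrite -actM [LHS]e1 actK.
Qed.

(* The sets fixed by the powers of [c] have bounded diameter by acylindricity,
   and so has their union, which the commensurator preserves. *)
Lemma acylindrical_commensurator_elliptic (G : groupType) (T : Ggraph G)
    (c : G) (v : T) :
  torsion_free G -> is_tree T -> acylindrical T -> c <> 1 ->
  act c v = v -> elliptic T (commensurator c).
Proof.
move=> htf tT [k acy] c1 cv.
apply: (@bounded_fix _ _ tT _ (cyl_vertex c) k).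
- exact: subgroup_commensurator.
- by exists v, 1%R.
- by move=> g x; exact: cyl_vertex_act.
move=> x y [m m0 mx] [n n0 ny].
have mn0 := mulz_neq0 m0 n0.
have [p xp] := simple_path_ex tT x y.
rewrite (distE tT xp) leqNgt; apply/negP => kp.
apply: (expgz_neq1 htf c1 mn0).
set g := expgz c (m * n)%R.
have gx : act g x = x by rewrite /g expgzM; exact: (subXz n (subgroup_vstab x)).
have gy : act g y = y.
  by rewrite /g GRing.mulrC expgzM; exact: (subXz m (subgroup_vstab y)).
have gp : map (act g) p = p.
  by apply: (simple_path_unique tT _ xp); have := simple_path_act g xp; rewrite gx gy.
have [pp up _] := xp; apply: (acy x p pp up kp) => u.
rewrite inE => /orP[/eqP -> //|].
by move: u; apply/eq_in_map; rewrite gp map_id.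
Qed.

(* A hyperbolic [a] with [t a t^-1 = a^s] has [|s| = 1], as [a] and its
   conjugate translate by the same amount. *)
Lemma hyperbolic_conj_power (G : groupType) (T : Ggraph G) (a t : G) (s : int) :
  is_tree T -> (forall v : T, act a v <> v) -> t * a * t^-1 = expgz a s ->
  s <> 0%R -> s = 1%R \/ s = (-1)%R.
Proof.
move=> tT na ta s0; have [p [L [L0 dp]]] := hyperbolic_axis tT na.
have dz k : dist p (act (expgz a k) p) = (`|k| * L)%N.
  case: k => n; first exact: dp.
  by rewrite /= -(dist_act tT (a ^+ n.+1)) actVK (distC tT) dp.
pose D := dist p (act t p).
have bound (n : nat) : (`|s| * n * L <= D + n * L + D)%N.
  have -> : (`|s| * n * L = dist p (act (expgz a (s * n)%R) p))%N.
    by rewrite dz abszM.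
  have e : expgz a (s * n)%R = t * a ^+ n * t^-1.
    by rewrite expgzM -ta -expgz_conj.
  have h1 : dist (act t p) (act (expgz a (s * n)%R) (act t p)) = (n * L)%N.
    by rewrite e !actM actK (dist_act tT) dp.
  have h2 : dist (act (expgz a (s * n)%R) (act t p)) (act (expgz a (s * n)%R) p) = D.
    by rewrite (dist_act tT) (distC tT).
  have := dist_triangle tT p (act t p) (act (expgz a (s * n)%R) p).
  have := dist_triangle tT (act t p) (act (expgz a (s * n)%R) (act t p))
    (act (expgz a (s * n)%R) p).
  rewrite h1 h2 -/D; lia.
(* For [n = 2D + 1] the bound reads [(|s| - 1) n L <= 2D], which excludes [|s| >= 2]. *)
have : (`|s| <= 1)%N by have := bound (D + D).+1; nia.
lia.
Qed.

Section TreeOfCylinders.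
Variables (G : groupType) (T : Ggraph G).
Hypotheses (hfg : fin_generated G) (htf : torsion_free G).
Hypothesis hct : commutative_transitive G.
Hypothesis ET : E_tree T.
Implicit Types (a c g h t : G) (H : set G) (u v x y : T).

Let tT : is_tree T := ET.1.

Definition Tc0 x (x0 : @cyl_V0 _ T x) : Tc T := inl (SigSub (mem_set x0)).
Definition Tc1 (Y : set (set T)) (Yc : is_cylinder Y) : Tc T :=
  inr (SigSub (mem_set Yc)).

Lemma vstab_inl (x : set_type (@cyl_V0 _ T)) :
  vstab (inl x : Tc T) = vstab (val x).
Proof.
apply/seteqP; split=> g; rewrite /vstab /=.
  by move=> e; have := congr1 (fun w : Tc T => if w is inl z then val z else val x) e.
by move=> e; congr inl; apply: val_inj.
Qed.

Lemma vstab_inr (Y : set_type (@cyl_V1 _ T)) c : edge_element T c ->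
  val Y = cyl_of c -> vstab (inr Y : Tc T) = commensurator c.
Proof.
move=> ec YE; apply/seteqP; split=> g; rewrite /vstab /= => h.
  apply/(cyl_stabP htf ET _ ec).
  have := congr1 (fun w : Tc T => if w is inr Z then val Z else val Y) h.
  by rewrite /= YE.
by congr inr; apply: val_inj; rewrite /= YE; apply/(cyl_stabP htf ET _ ec).
Qed.

Lemma inrE (Y : set_type (@cyl_V1 _ T)) :
  exists2 c, edge_element T c & val Y = cyl_of c.
Proof. exact/(cylinderP htf ET)/(set_mem (valP Y)). Qed.

Lemma estab_Tc (x : set_type (@cyl_V0 _ T)) (Y : set_type (@cyl_V1 _ T)) :
  @estab _ (Tc T) [set inl x; inr Y] =
  vstab (inl x : Tc T) `&` vstab (inr Y : Tc T).
Proof.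
apply/seteqP; split=> g; rewrite /estab /= -[_ @` _]/(@act_edge _ (Tc T) _ _) act_edge2.
  move=> e.
  have : [set (inl x : Tc T); inr Y] (act g (inl x : Tc T)) by rewrite -e; left.
  have : [set (inl x : Tc T); inr Y] (act g (inr Y : Tc T)) by rewrite -e; right.
  by move=> [//|eY] [ex|//].
by move=> [gx gY]; rewrite gx gY.
Qed.

(** Outside [cyl_V0] there is an edge at [v], and a generator of its stabilizer gives the only
    cylinder through [v]. The one-point tree falls under the first case. *)
Lemma vertex_cases v : cyl_V0 v \/ exists2 c, edge_element T c &
  cyl_vertex c v /\
  forall Y, is_cylinder Y -> in_cylinder v Y -> Y = cyl_of c.
Proof.
have [|nv] := pselect (cyl_V0 v); first by left.
right; have [y yv] : exists y : T, v <> y.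
  apply: contrapT => ny; apply: nv; right=> y; apply: contrapT => yv.
  by apply: ny; exists y => /esym.
have [z vz _] := fix_step ET yv.
have /(infinite_cyclicP htf)[c c1 cE] := vstab_adj_cyclic ET vz.
have [cv cz] : (vstab v `&` vstab z) c by rewrite cE; exists 1%R.
have ec : edge_element T c by split=> //; exists v, z.
have cy : cyl_vertex c v by exists 1%R.
exists c => //; split=> // Y Yc vY.
apply: contrapT => YE; apply: nv; left; exists Y, (cyl_of c); split=> //.
  exact: cyl_of_cylinder.
exact/(in_cylinderP ET v ec).
Qed.

Lemma vstab_sub_commensurator v c : edge_element T c ->
  (forall Y, is_cylinder Y -> in_cylinder v Y -> Y = cyl_of c) ->
  cyl_vertex c v -> vstab v `<=` commensurator c.
Proof.
move=> ec vu cv g gv; apply/(cyl_stabP htf ET _ ec).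
have Yc := cyl_of_cylinder htf ET ec.
apply: vu; first exact: is_cylinder_act.
have := in_cylinder_act g ((in_cylinderP ET v ec).2 cv).
by rewrite (gv : act g v = v).
Qed.

Lemma vstab_sub_Tc v : exists w : Tc T, vstab v `<=` vstab w.
Proof.
have [v0|[c ec [cv vu]]] := vertex_cases v.
  by exists (Tc0 v0); rewrite vstab_inl.
have Yc := cyl_of_cylinder htf ET ec.
exists (Tc1 Yc); rewrite (vstab_inr ec) //.
exact: vstab_sub_commensurator.
Qed.

Lemma elliptic_Tc H : elliptic T H -> elliptic (Tc T) H.
Proof.
move=> [v Hv]; have [w vw] := vstab_sub_Tc v.
by exists w; exact: subset_trans vw.
Qed.

Lemma noncyclic_cent x c : edge_element T c -> cyl_vertex c x ->
  ~ infinite_cyclic (vstab x `&` commensurator c) ->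
  ~ is_cyclic (vstab x `&` centralizer c).
Proof.
move=> [c1 _] cx ni cyc; apply: ni.
have sub := vstab_cyl_cent htf hct c1 cx cyc.
have [b bE] : is_cyclic (vstab x `&` commensurator c).
  apply: (cyclic_sub _ cyc) => [|g [gx gW]]; last by split=> //; exact: sub.
  exact: subI (subgroup_vstab x) (subgroup_commensurator c).
apply/(infinite_cyclicP htf); exists b => // b1.
have [z z1 [zx zc]] := cyl_vertex_infinite htf c1 cx.
have : (vstab x `&` commensurator c) z by split=> //; exact: commensurator_commute.
by rewrite bE b1 => -[n _]; rewrite expgz_of1 => /esym.
Qed.

(* The centralizer of [c] fixes no edge as soon as it is not cyclic. *)
Lemma noncyclic_fix_unique x y c : edge_element T c ->
  ~ is_cyclic (vstab x `&` centralizer c) -> commensurator c `<=` vstab y -> x = y.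
Proof.
move=> [c1 _] nc Wy; apply: contrapT => xy; apply: nc.
apply: (vstab2_cyclic ET _ xy) => [|g [gx gc]].
  exact: subI (subgroup_vstab x) (subgroup_centralizer c).
by split=> //; apply/Wy/commensurator_commute; exact: commute_sym.
Qed.

Lemma collapsed_inl (x : set_type (@cyl_V0 _ T)) (Y : set_type (@cyl_V1 _ T)) c :
  edge_element T c -> val Y = cyl_of c ->
  @collapsed _ (Tc T) (inl x) (inr Y) <->
  cyl_vertex c (val x) /\ ~ infinite_cyclic (vstab (val x) `&` commensurator c).
Proof.
move=> ec YE; rewrite /collapsed /= estab_Tc vstab_inl (vstab_inr ec YE) YE.
split=> -[+ ni]; split=> //; first by apply/(in_cylinderP ET _ ec)/asboolP.
by apply/asboolP/(in_cylinderP ET _ ec).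
Qed.

Lemma collapsed_sub (x : set_type (@cyl_V0 _ T)) (Y : set_type (@cyl_V1 _ T)) c :
  edge_element T c -> val Y = cyl_of c -> @collapsed _ (Tc T) (inl x) (inr Y) ->
  ~ is_cyclic (vstab (val x) `&` centralizer c) /\
  commensurator c `<=` vstab (val x).
Proof.
move=> ec YE /(collapsed_inl x ec YE)[cx ni].
have nc := noncyclic_cent ec cx ni; split=> //.
by apply: (noncyclic_commensurator_sub htf hct ET) nc; case: ec.
Qed.

Lemma collapsed_unique (x x' : set_type (@cyl_V0 _ T)) (Y : set_type (@cyl_V1 _ T)) :
  @collapsed _ (Tc T) (inl x) (inr Y) -> @collapsed _ (Tc T) (inl x') (inr Y) ->
  x = x'.
Proof.
have [c ec YE] := inrE Y.
move=> /(collapsed_sub ec YE)[nc _] /(collapsed_sub ec YE)[_ W'].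
exact/val_inj/(noncyclic_fix_unique ec nc).
Qed.

(* Each collapsed subtree is a single vertex or a star with centre in [cyl_V0]. *)
Definition star_center (w : Tc T) : Tc T :=
  match w with
  | inl x => inl x
  | inr Y =>
    match pselect (exists x : set_type (@cyl_V0 _ T),
        @collapsed _ (Tc T) (inl x) (inr Y)) with
    | left e => inl (sval (cid e))
    | right _ => inr Y
    end
  end.

Lemma star_center_inl (x : set_type (@cyl_V0 _ T)) (Y : set_type (@cyl_V1 _ T)) :
  @collapsed _ (Tc T) (inl x) (inr Y) -> star_center (inr Y) = inl x.
Proof.
move=> c; rewrite /star_center; case: pselect => [e|[]]; last by exists x.
by congr inl; apply: collapsed_unique c; exact: (svalP (cid e)).
Qed.

Lemma star_centerP (w : Tc T) :
  star_center w = w \/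
  exists (x : set_type (@cyl_V0 _ T)) Y, [/\ w = inr Y, star_center w = inl x &
    @collapsed _ (Tc T) (inl x) (inr Y)].
Proof.
case: w => [x|Y]; first by left.
have [[x c]|n] := pselect (exists x : set_type (@cyl_V0 _ T),
    @collapsed _ (Tc T) (inl x) (inr Y)).
  by right; exists x, Y; rewrite (star_center_inl c).
by left; rewrite /star_center; case: pselect.
Qed.

Lemma star_center_idem w : star_center (star_center w) = star_center w.
Proof. by have [e|[x [Y [_ e _]]]] := star_centerP w; rewrite e. Qed.

Lemma star_center_collapsed (u v : Tc T) :
  @collapsed _ (Tc T) u v -> star_center u = star_center v.
Proof.
case: u v => [x|Y] [x'|Y'] c //.
- by case: c.
- by rewrite (star_center_inl c).
- rewrite (@star_center_inl x' Y) //; case: c => a n; split=> //.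
  by rewrite setUC.
- by case: c.
Qed.

Lemma collapse_proj_center (u : Tc T) :
  collapse_proj (star_center u) = collapse_proj u.
Proof.
apply/collapse_projP; have [->|[x [Y [-> -> c]]]] := star_centerP u.
  exact: rst_refl.
exact: rst_step.
Qed.

Lemma collapse_proj_eq (u v : Tc T) :
  collapse_proj u = collapse_proj v <-> star_center u = star_center v.
Proof.
split=> [/collapse_projP|e].
  elim=> [a b|a|a b _ ->|a b d _ -> _ ->] //; exact: star_center_collapsed.
by rewrite -collapse_proj_center e collapse_proj_center.
Qed.

Lemma star_center_act g (w : Tc T) : star_center (act g w) = act g (star_center w).
Proof.
have [e|[x [Y [e1 e2 c]]]] := star_centerP w; last first.
  by rewrite e2 e1 -(star_center_collapsed (collapsed_act g c)).
have [-> //|[x [Y [e1 _ c]]]] := star_centerP (act g w); first by rewrite e.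
have := collapsed_act g^-1 c; rewrite -e1 actK.
move/star_center_collapsed; rewrite e => e2.
have {}e2 : act g^-1 (inl x : Tc T) = w := e2.
by move: e1; rewrite -e2 actVK.
Qed.

(** The centre is an equivariant choice of a representative in each class, so collapsing creates no
    new stabilizers. *)
Lemma vstab_collapse_proj (w : Tc T) :
  @vstab _ (Tc_star T) (collapse_proj w) = vstab (star_center w).
Proof.
apply/seteqP; split=> g; rewrite /vstab /= collapse_act_proj.
  by move/collapse_proj_eq; rewrite star_center_act.
by move=> e; apply/collapse_proj_eq; rewrite star_center_act.
Qed.

Lemma Tc_star_vertex (w : Tc_star T) : exists r : Tc T,
  [/\ star_center r = r, collapse_proj r = w & vstab w = vstab r].
Proof.
exists (star_center (collapse_repr w)).
rewrite star_center_idem collapse_proj_center collapse_reprK; split=> //.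
by rewrite -vstab_collapse_proj collapse_reprK.
Qed.

Lemma same_deformation_Tc_star : same_deformation_space (Tc_star T) (Tc T).
Proof.
move=> H _; split=> [[w Hw]|[w Hw]].
  by have [r [_ _ e]] := Tc_star_vertex w; exists r; rewrite -e.
exists (collapse_proj w) => g /Hw gw.
by rewrite /vstab /= collapse_act_proj (gw : act g w = w).
Qed.

(** Outside [cyl_V0], [vstab v] lies in [commensurator c] and is non-cyclic, so the commensurator
    fixes [v] and equals [vstab v]. The cylinder is not collapsed, as its centre could only be [v].
    Asking for a star centre serves [Tc T] and [Tc_star T] at once. *)
Lemma noncyclic_vstab v : ~ is_cyclic (vstab v) ->
  exists r : Tc T, star_center r = r /\ vstab r = vstab v.
Proof.
move=> nc; have [v0|[c ec [cv vu]]] := vertex_cases v.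
  by exists (Tc0 v0); rewrite vstab_inl.
have vW := vstab_sub_commensurator ec vu cv.
have [c1 _] := ec.
have ncA : ~ is_cyclic (vstab v `&` centralizer c).
  move=> cyc; apply: nc; have sub := vstab_cyl_cent htf hct c1 cv cyc.
  have -> // : vstab v = vstab v `&` centralizer c.
  apply/seteqP; split=> g; last by case.
  by move=> gv; split=> //; apply: sub; split=> //; exact: vW.
have Wv := noncyclic_commensurator_sub htf hct ET c1 ncA.
have WE : commensurator c = vstab v by apply/seteqP.
have Yc := cyl_of_cylinder htf ET ec.
exists (Tc1 Yc); rewrite (vstab_inr ec) //; split=> //.
have [//|[x [Y [eY _ col]]]] := star_centerP (Tc1 Yc).
have YE : val Y = cyl_of c by case: eY => <-.
have [_ Wx] := collapsed_sub ec YE col.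
have vx := noncyclic_fix_unique ec ncA Wx.
have x0 : cyl_V0 v by rewrite vx; exact: set_mem (valP x).
case: x0 => [[Z [Z' [cZ cZ' ZZ' vZ vZ']]]|vT].
  by case: ZZ'; rewrite (vu _ cZ vZ) (vu _ cZ' vZ').
have [_ [a [b [ab _ _]]]] := ec.
by move: ab; rewrite (vT a) (vT b) adj_irr.
Qed.

(** Suppose the stabilizer of a cylinder [Y] fixes a vertex [v]. If [v] is in [cyl_V0], the edge
    from [v] to [Y] has non-cyclic stabilizer and is collapsed, so [Y] is not a centre; otherwise
    the stabilizer is exactly [vstab v]. *)
Lemma Tc_star_new_stabilizer (w : Tc_star T) : ~ is_cyclic (vstab w) ->
  ~ (exists v, vstab v = vstab w) -> isomorphic_to_some_BS1 (vstab w).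
Proof.
have [r [rr _ ->]] := Tc_star_vertex w; case: r rr => [x|Y] rr nc nv.
  by case: nv; exists (val x); rewrite vstab_inl.
have [c ec YE] := inrE Y; have [c1 _] := ec.
rewrite (vstab_inr ec YE) in nc nv *.
have [[v Wv]|//] := cylinder_dichotomy htf hct ET ec hfg.
have cv : cyl_vertex c v.
  by exists 1%R => //; apply/Wv/commensurator_commute/commute_refl.
have vY : in_cylinder v (cyl_of c) by apply/(in_cylinderP ET v ec).
have [v0|[d ed [dv vu]]] := vertex_cases v.
  have col : @collapsed _ (Tc T) (Tc0 v0) (inr Y).
    apply/(collapsed_inl _ ec YE) => /=; split=> // -[cyc _]; apply: nc.
    have -> // : commensurator c = vstab v `&` commensurator c.
    by apply/seteqP; split=> g; [split=> //; exact: Wv|case].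
  by move: rr; rewrite (star_center_inl col).
case: nv; exists v; apply/seteqP; split=> //.
have Yc := cyl_of_cylinder htf ET ec.
have e := vu _ Yc vY.
by apply: (vstab_sub_commensurator ec) cv; rewrite e.
Qed.

Lemma edge_element_sub_Tc c H : edge_element T c -> H `<=` commensurator c ->
  elliptic (Tc T) H.
Proof.
move=> ec HW; have Yc := cyl_of_cylinder htf ET ec.
by exists (Tc1 Yc); rewrite (vstab_inr ec).
Qed.

Lemma fix2_edge_element x y c : c <> 1 -> x <> y -> act c x = x -> act c y = y ->
  edge_element T c.
Proof.
move=> c1 xy cx cy; have [z xz sub] := fix_step ET xy.
by have [_ cz] : (vstab x `&` vstab z) c by [apply: sub|]; split=> //; exists x, z.
Qed.

(** If [a] fixes [x] and [t] does not, [a^s] fixes both [x] and [act t x]. If [a] is hyperbolic,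
    then [s] is 1 or -1 and [t] commutes with [a]; a product of powers then fixes [p] and [act a p].
    In both cases an edge element has [a] and [t] in its commensurator. *)
Lemma BS_elliptic_Tc H : isomorphic_to_some_BS1 H -> elliptic (Tc T) H.
Proof.
move=> [s s0 [f [fM finj fH]]].
pose a := f (BS_a s); pose t := f (BS_t s).
have ta : t * a * t^-1 = expgz a s.
  by rewrite /t /a -(morph_expgz fM) -BS_rel !fM (morphV fM).
have indep m n : expgz a m * expgz t n = 1 -> m = 0%R /\ n = 0%R.
  move=> e; apply: (BS1_independent s0); apply: finj.
  by rewrite fM !(morph_expgz fM) e (morph1 fM).
have gen K : is_subgroup K -> K a -> K t -> H `<=` K.
  move=> sK Ka Kt; rewrite -fH => _ [u _ <-].
  elim/BS1_ind: u => [|u Ku|u Ku]; first by rewrite (morph1 fM); exact: sub1.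
    by rewrite !fM (morphV fM); split; apply: subM => //; exact: subV.
  by rewrite !fM (morphV fM); split; apply: subM => //; exact: subV.
have a1 : a <> 1.
  by move=> a1; have [] := indep 1%R 0%R; rewrite //= a1 mulg1.
have sW c := subgroup_commensurator c.
have [[x ax]|nell] := pselect (exists x : T, act a x = x).
  have [tx|tx] := pselect (act t x = x).
    apply: elliptic_Tc; exists x; exact: gen (subgroup_vstab x) ax tx.
  have b1 : expgz a s <> 1 by move=> /(expgz_eq1 htf a1).
  have eb : edge_element T (expgz a s).
    apply: (@fix2_edge_element (act t x) x) => //.
      by rewrite -ta !actM actK ax.
    exact: (subXz s (subgroup_vstab x) ax).
  apply: (edge_element_sub_Tc eb); apply: gen => //.
    by apply/commensurator_commute/commute_expgz/commute_refl.
  by exists 1%R, s; split=> //; rewrite expgz1 expgz_conj ta.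
have na v : act a v <> v by move=> av; apply: nell; exists v.
have cta : commute t a.
  apply: (conj_inv_commute htf hct a1); rewrite ta.
  have [->|->] := hyperbolic_conj_power tT na ta s0; first by left.
  by right; rewrite expgzN.
have [p [L [L0 dp]]] := hyperbolic_axis tT na.
have F0 := axis_tails0 a p.
have FN := @axis_tailsN _ _ a p.
have FD := @axis_tailsD _ _ a p.
have sa := axis_shift_self tT L0 dp.
have [k sk] := shift_ex tT F0 FD (axis_tailsA tT L0 dp) (axis_horo_inv tT L0 dp cta).
(* The shifts of [a] and [t] are [-L] and [k], so these exponents make them cancel. *)
pose z := expgz a k * expgz t L.
have za : commute z a.
  apply/commute_sym/commuteM; apply/commute_expgz; first exact: commute_refl.
  exact: commute_sym.
have zp : act z p = p.
  apply: (axis_shift0_fix tT L0 dp za).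
  have := shiftM FD (shift_expgz F0 FD k sa) (shift_expgz F0 FD L%:Z sk).
  by rewrite (_ : (k * _ + _ = 0)%R) //; ring.
have z1 : z <> 1 by move=> /indep[_ []]; lia.
have ez : edge_element T z.
  apply: (@fix2_edge_element (act a p) p) => //.
  by rewrite -actM za actM zp.
apply: (edge_element_sub_Tc ez); apply: gen => //; apply: commensurator_commute.
  exact: commute_sym.
by apply: commuteM; apply: commute_expgz => //; exact: commute_refl.
Qed.

Lemma Tc_deformation_of_BS :
  (forall H, is_subgroup H -> isomorphic_to_some_BS1 H -> elliptic T H) ->
  same_deformation_space (Tc T) T.
Proof.
move=> BSell H sH; split=> [[w Hw]|]; last exact: elliptic_Tc.
case: w Hw => [x|Y]; first by rewrite vstab_inl; exists (val x).
have [c ec YE] := inrE Y; rewrite (vstab_inr ec YE) => HW.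
have [v Wv] : elliptic T (commensurator c).
  have [//|] := cylinder_dichotomy htf hct ET ec hfg.
  by apply: BSell; exact: subgroup_commensurator.
by exists v; exact: subset_trans Wv.
Qed.

(** One end comes from a cylinder [Y]. If [Y] is its own centre, [g] and a power of [c] lie in the
    infinite cyclic stabilizer of the edge; if [Y] is collapsed to [x'], both fix the distinct
    vertices [val x] and [val x']. Either way [g] and [c] have a common non-zero power. *)
Lemma Tc_star_edge_fix (w w' : Tc_star T) g : g <> 1 -> adj w w' ->
  act g w = w -> act g w' = w' ->
  exists2 Y : set_type (@cyl_V1 _ T), val Y = cyl_of g &
    w = collapse_proj (inr Y : Tc T) \/ w' = collapse_proj (inr Y : Tc T).
Proof.
move=> g1 /andP[/eqP ww' /asboolP[u [v [uw vw uv]]]].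
wlog [x [Y [ux vY]]] : w w' u v ww' uw vw uv /
    exists (x : set_type (@cyl_V0 _ T)) Y, u = inl x /\ v = inr Y.
  move=> W gw gw'; case: u v uv uw vw => [x|Y] [x'|Y'] uv uw vw //.
    by apply: (W w w' (inl x) (inr Y')) => //; exists x, Y'.
  have vu : @adj _ (Tc T) (inl x') (inr Y) by [].
  have [|Z eZ h] := W w' w (inl x') (inr Y) (nesym ww') vw uw vu _ gw' gw.
    by exists x', Y.
  by exists Z => //; tauto.
move=> gw gw'; subst u v.
have [c ec YE] := inrE Y; have [c1 _] := ec.
have [m m0 mx] : cyl_vertex c (val x).
  by apply/(in_cylinderP ET _ ec); rewrite -YE; exact/asboolP.
have gx : act g (val x) = val x.
  have : @vstab _ (Tc_star T) (collapse_proj (inl x : Tc T)) g by rewrite uw.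
  by rewrite vstab_collapse_proj vstab_inl.
have gY : vstab (star_center (inr Y)) g.
  by rewrite -vstab_collapse_proj vw.
exists Y; last by right.
rewrite YE.
have [e|[x' [Y' [[YY'] e col]]]] := star_centerP (inr Y).
  rewrite e (vstab_inr ec YE) in gY.
  have ncol : ~ @collapsed _ (Tc T) (inl x) (inr Y).
    move/star_center_inl => e'; apply: ww'.
    by rewrite -uw -vw; apply/collapse_proj_eq; rewrite e'.
  have /(infinite_cyclicP htf)[b b1 bE] :
      infinite_cyclic (vstab (val x) `&` commensurator c).
    apply: contrapT => ni; apply: ncol; apply/(collapsed_inl _ ec YE); split=> //.
    by exists m.
  have : (vstab (val x) `&` commensurator c) g by [].
  have : (vstab (val x) `&` commensurator c) (expgz c m).
    by split=> //; apply/commensurator_commute/commute_sym/commute_expgz/commute_refl.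
  rewrite bE => -[i _ ci] [j _ gj].
  have i0 : i <> 0%R by move=> i0; apply: (expgz_neq1 htf c1 m0); rewrite -ci i0.
  have j0 : j <> 0%R by move=> j0; apply: g1; rewrite -gj j0.
  apply: (cyl_of_eq ET (mulz_neq0 m0 j0) i0).
  by rewrite expgzM -ci -gj -!expgzM GRing.mulrC.
subst Y'; rewrite e vstab_inl in gY.
have [[n n0 nx'] _] := (collapsed_inl x' ec YE).1 col.
have xx' : val x <> val x'.
  move=> /val_inj xx'; apply: ww'; rewrite -uw -vw; apply/collapse_proj_eq.
  by rewrite e xx'.
have [z xz sub] := fix_step ET xx'.
have cmn : (vstab (val x) `&` vstab z) (expgz c (m * n)%R).
  apply: sub; split; first by rewrite expgzM; exact: (subXz n (subgroup_vstab _)).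
  by rewrite GRing.mulrC expgzM; exact: (subXz m (subgroup_vstab _)).
have gxz : (vstab (val x) `&` vstab z) g by exact: sub.
have mn0 := mulz_neq0 m0 n0.
have [i [j [i0 j0 ij]]] :=
  edge_common_power htf ET xz (expgz_neq1 htf c1 mn0) g1 cmn gxz.
apply: (cyl_of_eq ET (mulz_neq0 mn0 i0) j0).
by rewrite expgzM ij.
Qed.

(** The first and third edges of a segment have no common end, but if a non-trivial [g] fixes both,
    the class of its cylinder is an end of each. *)
Lemma Tc_star_acylindrical : k_acylindrical (Tc_star T) 2.
Proof.
move=> w0 [|w1 [|w2 [|w3 p]]] // pp up _ g fixg; apply: contrapT => g1.
move: pp up => /= /and4P[a01 _ a23 _].
rewrite !inE !negb_or => /and4P[/and4P[_ n02 n03 _] /and3P[n12 n13 _] _ _].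
have fx i : i \in [:: w0, w1, w2, w3 & p] -> act g i = i := fixg i.
have [Y YE h] : exists2 Y : set_type (@cyl_V1 _ T), val Y = cyl_of g &
    w0 = collapse_proj (inr Y : Tc T) \/ w1 = collapse_proj (inr Y : Tc T).
  by apply: Tc_star_edge_fix => //; apply: fx; rewrite !inE eqxx ?orbT.
have [Y' YE' h'] : exists2 Y : set_type (@cyl_V1 _ T), val Y = cyl_of g &
    w2 = collapse_proj (inr Y : Tc T) \/ w3 = collapse_proj (inr Y : Tc T).
  by apply: Tc_star_edge_fix => //; apply: fx; rewrite !inE eqxx ?orbT.
have e : Y = Y' by apply: val_inj; rewrite YE YE'.
subst Y'; move: n02 n03 n12 n13.
by case: h => ->; case: h' => ->; rewrite eqxx.
Qed.

(** Stabilizers of vertices of [T] are elliptic in [T'] through [f]. For a cylinder, [c] fixes the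
    image of a vertex, and acylindricity of [T'] extends this to its commensurator. *)
Lemma Tc_star_dominates (T' : Ggraph G) : is_tree T' -> acylindrical T' ->
  dominates T T' -> dominates (Tc_star T) T'.
Proof.
move=> tT' acy [f fE]; apply: dominates_of_elliptic => w.
have [r [_ _ ->]] := Tc_star_vertex w; case: r => [x|Y].
  by exists (f (val x)) => g; rewrite vstab_inl /vstab /= -fE => ->.
have [c ec YE] := inrE Y; rewrite (vstab_inr ec YE).
have [c1 [u [_ [_ cu _]]]] := ec.
by apply: (acylindrical_commensurator_elliptic (v := f u)) => //; rewrite -fE cu.
Qed.

End TreeOfCylinders.

Theorem proposition6p5 (G : groupType)
    (hfg : fin_generated G) (htf : torsion_free G)
    (hct : commutative_transitive G)
    (T : Ggraph G) (hT : E_tree T) :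
  same_deformation_space (Tc_star T) (Tc T)
  /\
  ((forall v : T, ~ is_cyclic (vstab v) ->
      (exists w : Tc T, vstab w = vstab v) /\
      (exists w : Tc_star T, vstab w = vstab v))
   /\
   (forall w : Tc_star T, ~ is_cyclic (vstab w) ->
      ~ (exists v : T, vstab v = vstab w) ->
      isomorphic_to_some_BS1 (vstab w))
   /\
   (forall H : set G, is_subgroup H -> isomorphic_to_some_BS1 H ->
      elliptic (Tc T) H /\ elliptic (Tc_star T) H)
   /\
   (same_deformation_space (Tc T) T /\ same_deformation_space (Tc_star T) T
    <->
    forall H : set G, is_subgroup H -> isomorphic_to_some_BS1 H ->
      elliptic T H))
  /\
  (k_acylindrical (Tc_star T) 2
   /\
   forall T' : Ggraph G, E_tree T' -> acylindrical T' -> dominates T T' ->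
     dominates (Tc_star T) T').
Proof.
have star := same_deformation_Tc_star htf hct hT.
have BSTc := BS_elliptic_Tc htf hct hT.
split=> //; split; last first.
  split; first exact: Tc_star_acylindrical.
  by move=> T' [tT' _]; exact: Tc_star_dominates.
split.
  move=> v /(noncyclic_vstab htf hct hT)[r [rr rv]]; split; first by exists r.
  by exists (collapse_proj r); rewrite vstab_collapse_proj // rr.
split; first by move=> w; exact: Tc_star_new_stabilizer.
split; first by move=> H sH /BSTc h; split=> //; apply/star.
split=> [[TcT _] H sH /BSTc|BSell]; first by move/(TcT H sH).
have TcT := Tc_deformation_of_BS hfg htf hct hT BSell.
by split=> // H sH; rewrite (star H sH); exact: TcT.
Qed.
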